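(* Let $\Lambda$ be a row-finite $k$-graph with no sources, let $\mathcal{G}_\Lambda$ be its path groupoid, and let $\mathcal{A}$ be a right $\Lambda$-module. For each $x\in\Lambda^\infty$ define $$\underline{\mathcal{A}}(x):=\varinjlim_{(p,q)\in\Omega_k}\bigl(\mathcal{A}_{x(p)},\ \mathcal{A}(x(p,q))\bigr).$$ (1) There is a topology on $\underline{\mathcal{A}}:=\bigsqcup_{x\in\Lambda^\infty}\underline{\mathcal{A}}(x)$ (the one generated by the sets $S_{a,\lambda}$ described in the context) which, with the action of $\mathcal{G}_\Lambda$ described in the context, makes $\underline{\mathcal{A}}$ into a $\mathcal{G}_\Lambda$-sheaf. (2) Let $\mathcal{B}$ be a right $\Lambda$-module and $\eta\in\operatorname{Hom}_\Lambda(\mathcal{A},\mathcal{B})$. Then for any $x\in\Lambda^\infty$, $$\varinjlim_{(p,q)\in\Omega_k}\eta\circ\mathcal{A}(x(p,q))=\varinjlim_{(p,q)\in\Omega_k}\mathcal{B}(x(p,q))\circ\eta$$ as homomorphisms $\underline{\mathcal{A}}(x)\to\underline{\mathcal{B}}(x)$, and consequently one obtains a well-defined element $\underline{\eta}\in\operatorname{Hom}_{\mathcal{G}_\Lambda}(\underline{\mathcal{A}},\underline{\mathcal{B}})$ such that $\underline{\eta}([a])=[\eta(a)]$ for any $x\in\Lambda^\infty$ and any $[a]\in\underline{\mathcal{A}}(x)$. (3) The assignment $\mathcal{A}\mapsto\underline{\mathcal{A}}$, $\eta\mapsto\underline{\eta}$ defines an exact functor from the abelian category of right $\Lambda$-modules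 to the abelian category of $\mathcal{G}_\Lambda$-sheaves, and the induced map $\operatorname{Hom}_\Lambda(\mathcal{A},\mathcal{B})\to\operatorname{Hom}_{\mathcal{G}_\Lambda}(\underline{\mathcal{A}},\underline{\mathcal{B}})$ is a homomorphism of abelian groups.
   Context: **$\Lambda$-modules.** Categories are viewed arrows-only: $\lambda\in\Lambda$ means $\lambda$ is a morphism, with range $r(\lambda)$ and source $s(\lambda)$; objects are identified with identity morphisms; $\lambda\mu$ is defined when $s(\lambda)=r(\mu)$. A right $\Lambda$-module is a contravariant functor $\mathcal{A}:\Lambda\to\mathbf{Ab}$: abelian groups $\mathcal{A}_v$ for objects $v$ and homomorphisms $\mathcal{A}(\lambda):\mathcal{A}_{r(\lambda)}\to\mathcal{A}_{s(\lambda)}$. Morphisms are natural transformations; their group is $\operatorname{Hom}_\Lambda(\mathcal{A},\mathcal{B})$. Exactness is checked at each object $v$. **$k$-graphs.** $\mathbb{N}=\{0,1,2,\dots\}$. A $k$-graph is a countable category $\Lambda$ with a functor $d:\Lambda\to\mathbb{N}^k$ such that if $d(\lambda)=m+n$ then there are unique $\mu,\nu\in\Lambda$ with $\lambda=\mu\nu$, $d(\mu)=m$, $d(\nu)=n$. Write $\Lambda^n=d^{-1}(n)$ and $\Lambda^0=\operatorname{Obj}(\Lambda)$ (vertices). $\Lambda$ is row-finite with no sources if $0<|\{\lambda\in\Lambda^m:r(\lambda)=v\}|<\infty$ for all $m\in\mathbb{N}^k$, $v\in\Lambda^0$. $\Omega_k$ is the $k$-graph with objects $\mathbb{N}^k$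 and morphisms $(m,n)$, $m\le n$, with $r(m,n)=m$, $s(m,n)=n$, $(m,n)(n,p)=(m,p)$, $d(m,n)=n-m$. $\Lambda^\infty$ is the set of degree-preserving functors $x:\Omega_k\to\Lambda$; $x(p)=x(p,p)$ is a vertex and $x(p,q)$ is a morphism with range $x(p)$ and source $x(q)$. For $\lambda\in\Lambda$, $Z(\lambda)=\{x\in\Lambda^\infty:x(0,d(\lambda))=\lambda\}$; these sets form a basis of compact open sets for the topology of $\Lambda^\infty$. The shift is $\sigma^p(x)(m,n)=x(m+p,n+p)$. **Path groupoid.** $\mathcal{G}_\Lambda=\{(x,n,y)\in\Lambda^\infty\times\mathbb{Z}^k\times\Lambda^\infty:\exists j,\ell\in\mathbb{N}^k,\ n=j-\ell,\ \sigma^j(x)=\sigma^\ell(y)\}$, with $r(x,n,y)=x$, $s(x,n,y)=y$ (identifying $\mathcal{G}_\Lambda^{(0)}=\{(x,0,x)\}$ with $\Lambda^\infty$), $(x,n,y)(y,m,z)=(x,n+m,z)$. Its topology has as basis the sets $Z(\lambda,\mu)=\{(x,d(\lambda)-d(\mu),y)\in\mathcal{G}_\Lambda: x=\lambda z,\ y=\mu z\text{ for some }z\in\Lambda^\infty\}$, $s(\lambda)=s(\mu)$, making $\mathcal{G}_\Lambda$ a locally compact Hausdorff étale groupoid. (Here $\lambda z$ is the unique infinite path with $(\lambda z)(0,d(\lambda))=\lambda$ and $\sigma^{d(\lambda)}(\lambda z)=z$.) **$\mathcal{G}$-sheaves.** A sheaf of abelian groups over a space $X$ is a space $\mathscr{A}$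 with a local homeomorphism $\pi:\mathscr{A}\to X$ whose fibers $\mathscr{A}(x)=\pi^{-1}(x)$ are abelian groups, with continuous fiberwise operations. For an étale groupoid $\mathcal{G}$, a $\mathcal{G}$-sheaf is a sheaf of abelian groups over $\mathcal{G}^{(0)}$ with isomorphisms $\alpha_\gamma:\mathscr{A}(s(\gamma))\to\mathscr{A}(r(\gamma))$, $\gamma\in\mathcal{G}$, such that $\alpha_x=\mathrm{id}$ for units $x$, $\alpha_{\gamma_1}\circ\alpha_{\gamma_2}=\alpha_{\gamma_1\gamma_2}$ for composable pairs, and $(\gamma,a)\mapsto\alpha_\gamma(a)$ is continuous on $\{(\gamma,a):s(\gamma)=\pi(a)\}$. A morphism $f\in\operatorname{Hom}_{\mathcal{G}}(\mathscr{A},\mathscr{B})$ is a continuous map that maps fibers to fibers over the same point by homomorphisms and commutes with the actions. $\mathcal{G}$-sheaves form an abelian category. A functor between abelian categories is exact if it preserves exact sequences. **Topology and action on $\underline{\mathcal{A}}$.** Let $\varphi^x_p:\mathcal{A}_{x(p)}\to\underline{\mathcal{A}}(x)$ be the natural map; $[a]$ denotes $\varphi^x_p(a)$. The topology on $\underline{\mathcal{A}}$ is generated by the sets $S_{a,\lambda}=\{\varphi^y_{d(\lambda)}(a):y\in Z(\lambda)\}$ for $\lambda\in\Lambda$, $a\in\mathcal{A}_{s(\lambda)}$; the projection sends $\underline{\mathcal{A}}(x)$ to $x$. The action is: if $(x,n,y)\in\mathcal{G}_\Lambda$ and $\underline{b}\in\underline{\mathcal{A}}(y)$, write $\underline{b}=\varphi^y_q(b)$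 with $b\in\mathcal{A}_{y(q)}$ and $q$ large enough that $p:=n+q\in\mathbb{N}^k$ and $\sigma^p(x)=\sigma^q(y)$ (so $x(p)=y(q)$), and put $\alpha_{(x,n,y)}(\underline{b})=\varphi^x_p(b)$. *)

(* Defs.v *)
From HB Require Import structures.
From mathcomp Require Import all_boot all_order all_algebra.
From mathcomp Require Import all_classical topology.

Set Implicit Arguments.
Unset Strict Implicit.
Unset Printing Implicit Defensive.

Import GRing.Theory.
Local Open Scope classical_set_scope.
Local Open Scope ring_scope.
Local Open Scope quotient_scope.

Notation Nk k := {ffun 'I_k -> nat}.
Notation Zk k := {ffun 'I_k -> int}.

Section Nk.
Variable k : nat.
Implicit Types m n p : Nk k.

Definition nk_le m n : bool := [forall i, m i <= n i]%N.
Definition nk_sub m n : Nk k := [ffun i => m i - n i]%N.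
Definition nk_max m n : Nk k := [ffun i => maxn (m i) (n i)].
Definition nk_int m : Zk k := [ffun i => (m i)%:Z].

End Nk.

Notation "m <=k n" := (nk_le m n) (at level 70, no associativity).

Section NkTheory.
Variable k : nat.
Implicit Types m n p : Nk k.

Lemma nk_leP m n : reflect (forall i, m i <= n i)%N (m <=k n).
Proof. exact: forallP. Qed.

Lemma nk_le_refl m : m <=k m.
Proof. exact/nk_leP. Qed.

Lemma nk_le_trans m n p : m <=k n -> n <=k p -> m <=k p.
Proof.
by move=> /nk_leP h1 /nk_leP h2; apply/nk_leP => i; apply: leq_trans (h2 i).
Qed.

Lemma nk_le0 m : 0 <=k m.
Proof. by apply/nk_leP => i; rewrite ffunE. Qed.

Lemma nk_le_add m n p : m <=k n -> (m + p) <=k (n + p).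
Proof.
by move=> /nk_leP h; apply/nk_leP => i; rewrite !ffunE leq_add2r.
Qed.

Lemma nk_le_maxl m n : m <=k nk_max m n.
Proof. by apply/nk_leP => i; rewrite ffunE leq_maxl. Qed.

Lemma nk_le_maxr m n : n <=k nk_max m n.
Proof. by apply/nk_leP => i; rewrite ffunE leq_maxr. Qed.

Lemma nk_intD m n : nk_int (m + n) = nk_int m + nk_int n.
Proof. by apply/ffunP => i; rewrite !ffunE. Qed.

Lemma nk_int0 : nk_int (0 : Nk k) = 0.
Proof. by apply/ffunP => i; rewrite !ffunE. Qed.

End NkTheory.

Definition gen_space (T : Type) (B : set (set T)) : Type := T.

HB.instance Definition _ T (B : set (set T)) := gen_eqMixin (gen_space B).
HB.instance Definition _ T (B : set (set T)) := gen_choiceMixin (gen_space B).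
HB.instance Definition _ T (B : set (set T)) :=
  isSubBaseTopological.Build (gen_space B) B id.

Definition gen_topology (T : Type) (B : set (set T)) : Topological T :=
  Topological.class (gen_space B).

(* Continuity on a domain [D] that carries the topology pulled back along
   [j : D -> X]; used for subspaces of products presented as sigma types. *)
Definition continuous_along (D : Type) (X Y : topologicalType)
    (j : D -> X) (f : D -> Y) : Prop :=
  continuous (f : initial_topology (j : {classic D} -> X) -> Y).

Lemma continuous_along_comp (D : Type) (X Y Z : topologicalType)
    (j : D -> X) (f : D -> Y) (h : Z -> D) :
  continuous_along j f -> continuous (j \o h) -> continuous (f \o h).
Proof.
move=> /continuousP cf /continuousP cj; apply/continuousP => U oU.
have [V oV jVU] := cf _ oU.
have -> : (f \o h) @^-1` U = (j \o h) @^-1` V.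
  exact: esym (congr1 (fun W : set D => h @^-1` W) jVU).
exact: cj.
Qed.

Definition local_homeo (E X : topologicalType) (p : E -> X) : Prop :=
  forall e : E, exists (U : set E) (g : X -> E),
    [/\ open U, U e & open (p @` U)] /\
    [/\ {within U, continuous p}, {within p @` U, continuous g} &
        {in U, cancel p g}].

Lemma local_homeo_cts (E X : topologicalType) (p : E -> X) :
  local_homeo p -> continuous p.
Proof.
move=> hp e; have [U [g [[oU Ue _] [cU _ _]]]] := hp e.
by move: cU; rewrite continuous_open_subspace // => /(_ e); apply; rewrite inE.
Qed.

Record precat := PreCat {
  cob :> Type;
  mor : cob -> cob -> zmodType;
  cid : forall A, mor A A;
  ccomp : forall A B C, mor B C -> mor A B -> mor A C;
  ccompA : forall A B C D (h : mor C D) (g : mor B C) (f : mor A B),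
    ccomp h (ccomp g f) = ccomp (ccomp h g) f;
  ccomp1f : forall A B (f : mor A B), ccomp (cid B) f = f;
  ccompf1 : forall A B (f : mor A B), ccomp f (cid A) = f;
  ccompDl : forall A B C (g g' : mor B C) (f : mor A B),
    ccomp (g + g') f = ccomp g f + ccomp g' f;
  ccompDr : forall A B C (g : mor B C) (f f' : mor A B),
    ccomp g (f + f') = ccomp g f + ccomp g f' }.

Section Exactness.
Variable C : precat.

Definition is_kernel (K X Y : C) (f : mor X Y) (i : mor K X) : Prop :=
  ccomp f i = 0 /\
  forall (T : C) (h : mor T X), ccomp f h = 0 ->
    exists! u : mor T K, ccomp i u = h.

Definition is_cokernel (X Y Q : C) (f : mor X Y) (c : mor Y Q) : Prop :=
  ccomp c f = 0 /\
  forall (T : C) (h : mor Y T), ccomp h f = 0 ->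
    exists! u : mor Q T, ccomp u c = h.

(* im f = ker g as subobjects of Y, where im f := ker (coker f). *)
Definition exact_at (X Y Z : C) (f : mor X Y) (g : mor Y Z) : Prop :=
  exists (Q : C) (c : mor Y Q) (K : C) (i : mor K Y),
    [/\ is_cokernel f c, is_kernel c i & is_kernel g i].

End Exactness.

(* Functors with prescribed object map. *)
Record functor_on (C D : precat) (F : C -> D) := FunctorOn {
  fmap :> forall A B : C, mor A B -> mor (F A) (F B);
  fmap_id : forall A, fmap (cid A) = cid (F A);
  fmap_comp : forall A B E (g : mor B E) (f : mor A B),
    fmap (ccomp g f) = ccomp (fmap g) (fmap f) }.

Definition exact_functor (C D : precat) (Fo : C -> D) (F : functor_on Fo) :=
  forall (X Y Z : C) (f : mor X Y) (g : mor Y Z),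
    exact_at f g -> exact_at (F _ _ f) (F _ _ g).

Record dsystem (k : nat) := DSystem {
  dob :> Nk k -> zmodType;
  dmap : forall p q, p <=k q -> {additive dob p -> dob q};
  dmap_id : forall p (h : p <=k p) a, dmap h a = a;
  dmap_comp : forall p q r (h : p <=k q) (h' : q <=k r) (h'' : p <=k r) a,
    dmap h'' a = dmap h' (dmap h a) }.

Arguments dmap {k d p q} h.

Section DirectLimit.
Variables (k : nat) (D : dsystem k).

Definition dsum : Type := {p : Nk k & D p}.
HB.instance Definition _ := gen_eqMixin dsum.
HB.instance Definition _ := gen_choiceMixin dsum.

Definition deq_prop (u v : dsum) : Prop :=
  exists r (hu : projT1 u <=k r) (hv : projT1 v <=k r),
    dmap hu (projT2 u) = dmap hv (projT2 v).
Definition deq (u v : dsum) : bool := `[< deq_prop u v >].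

Lemma deq_refl : reflexive deq.
Proof. by move=> u; apply/asboolP; exists (projT1 u), (nk_le_refl _), (nk_le_refl _). Qed.

Lemma deq_sym : symmetric deq.
Proof.
by move=> u v; apply/asboolP/asboolP => -[r [hu [hv e]]]; exists r, hv, hu.
Qed.

Lemma dmap_max p q r s (hp : p <=k r) (hq : q <=k r) (h : r <=k s)
    (hp' : p <=k s) (hq' : q <=k s) (a : D p) (b : D q) :
  dmap hp a = dmap hq b -> dmap hp' a = dmap hq' b.
Proof. by move=> e; rewrite (dmap_comp hp h) e -(dmap_comp hq h hq'). Qed.

Lemma deq_trans : transitive deq.
Proof.
move=> v u w /asboolP[r [hu [hv e]]] /asboolP[s [hv' [hw e']]].
apply/asboolP; have hr := nk_le_maxl r s; have hs := nk_le_maxr r s.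
exists (nk_max r s), (nk_le_trans hu hr), (nk_le_trans hw hs).
rewrite (dmap_max hr _ (nk_le_trans hv hr) e).
exact: (dmap_max hs _ _ e').
Qed.

Definition deq_equiv := EquivRel deq deq_refl deq_sym deq_trans.

Definition dlim : Type := {eq_quot deq_equiv}.
HB.instance Definition _ := Choice.on dlim.
HB.instance Definition _ := EqQuotient.on dlim.

Definition dlim_in p (a : D p) : dlim := \pi_dlim (existT _ p a : dsum).

Lemma dlim_eq p q (a : D p) (b : D q) :
  dlim_in a = dlim_in b <->
  exists r (hp : p <=k r) (hq : q <=k r), dmap hp a = dmap hq b.
Proof.
split; first by move=> /eqmodP /asboolP.
by move=> h; apply/eqmodP/asboolP.
Qed.

Lemma dlim_in_dmap p q (h : p <=k q) (a : D p) : dlim_in (dmap h a) = dlim_in a.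
Proof.
apply/dlim_eq; exists q, (nk_le_refl q), h.
by rewrite dmap_id.
Qed.

Lemma dlim_surj (z : dlim) : exists p (a : D p), z = dlim_in a.
Proof.
exists (projT1 (repr z)), (projT2 (repr z)).
by rewrite /dlim_in -[LHS]reprK; congr (\pi _); case: (repr z).
Qed.

Definition drep_add (u v : dsum) : dsum :=
  existT _ (nk_max (projT1 u) (projT1 v))
    (dmap (nk_le_maxl _ _) (projT2 u) + dmap (nk_le_maxr _ _) (projT2 v)).
Definition dlim_add (y z : dlim) : dlim := \pi_dlim (drep_add (repr y) (repr z)).
Definition dlim_opp (y : dlim) : dlim := dlim_in (- projT2 (repr y)).
Definition dlim_zero : dlim := dlim_in (0 : D 0).

Lemma repr_dlim_in p (a : D p) :
  exists r (h : projT1 (repr (dlim_in a)) <=k r) (h' : p <=k r),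
    dmap h (projT2 (repr (dlim_in a))) = dmap h' a.
Proof.
have := reprK (dlim_in a); move: (repr _) => [q b] /= e.
exact/dlim_eq.
Qed.

Lemma dlim_addE p (a b : D p) : dlim_add (dlim_in a) (dlim_in b) = dlim_in (a + b).
Proof.
have [r [hr [hpr er]]] := repr_dlim_in a.
have [s [hs [hps es]]] := repr_dlim_in b.
rewrite /dlim_add /drep_add.
set u := repr (dlim_in a) in hr er *; set v := repr (dlim_in b) in hs es *.
have hr' := nk_le_maxl r s; have hs' := nk_le_maxr r s.
have ur := nk_le_trans hr hr'; have vs := nk_le_trans hs hs'.
have pm := nk_le_trans hpr hr'.
have uvm : nk_max (projT1 u) (projT1 v) <=k nk_max r s.
  apply/nk_leP => i; move/nk_leP: ur => /(_ i); move/nk_leP: vs => /(_ i).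
  by rewrite [in X in X -> _]ffunE [in X in _ -> X -> _]ffunE !ffunE geq_max => -> ->.
apply/dlim_eq; exists (nk_max r s), uvm, pm.
rewrite !raddfD; congr (_ + _).
  rewrite -(dmap_comp _ _ ur); exact: (dmap_max hr' _ _ er).
rewrite -(dmap_comp _ _ vs); exact: (dmap_max hs' _ _ es).
Qed.

Lemma dlim_oppE p (a : D p) : dlim_opp (dlim_in a) = dlim_in (- a).
Proof.
have [r [hr [hpr er]]] := repr_dlim_in a.
by apply/dlim_eq; exists r, hr, hpr; rewrite !raddfN er.
Qed.

Lemma dlim_zeroE p : dlim_in (0 : D p) = dlim_zero.
Proof. by apply/dlim_eq; exists p, (nk_le_refl p), (nk_le0 p); rewrite !raddf0. Qed.

Lemma dlim_surj2 (y z : dlim) :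
  exists p (a b : D p), y = dlim_in a /\ z = dlim_in b.
Proof.
have [p [a ->]] := dlim_surj y; have [q [b ->]] := dlim_surj z.
exists (nk_max p q), (dmap (nk_le_maxl p q) a), (dmap (nk_le_maxr p q) b).
by rewrite !dlim_in_dmap.
Qed.

Lemma dlim_addA : associative dlim_add.
Proof.
move=> x y z; have [p [a ->]] := dlim_surj x.
have [q [b [c [-> ->]]]] := dlim_surj2 y z.
rewrite -(dlim_in_dmap (nk_le_maxl p q)) -(dlim_in_dmap (nk_le_maxr p q) b).
rewrite -(dlim_in_dmap (nk_le_maxr p q) c).
by rewrite !dlim_addE addrA.
Qed.

Lemma dlim_addC : commutative dlim_add.
Proof.
move=> y z; have [q [b [c [-> ->]]]] := dlim_surj2 y z.
by rewrite !dlim_addE addrC.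
Qed.

Lemma dlim_add0 : left_id dlim_zero dlim_add.
Proof.
move=> y; have [q [b ->]] := dlim_surj y.
by rewrite -(dlim_zeroE q) dlim_addE add0r.
Qed.

Lemma dlim_addN : left_inverse dlim_zero dlim_opp dlim_add.
Proof.
move=> y; have [q [b ->]] := dlim_surj y.
by rewrite dlim_oppE dlim_addE addNr dlim_zeroE.
Qed.

HB.instance Definition _ := GRing.isZmodule.Build dlim
  dlim_addA dlim_addC dlim_add0 dlim_addN.

Lemma dlim_in_is_additive p : zmod_morphism (@dlim_in p).
Proof. by move=> a b; rewrite -dlim_addE -dlim_oppE. Qed.

HB.instance Definition _ p := GRing.isZmodMorphism.Build (D p) dlim
  (@dlim_in p) (@dlim_in_is_additive p).

Lemma dlim_universal (T : zmodType) (t : forall p, {additive D p -> T}) :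
  (forall p q (h : p <=k q) a, t q (dmap h a) = t p a) ->
  exists! f : dlim -> T,
    zmod_morphism f /\ forall p (a : D p), f (dlim_in a) = t p a.
Proof.
move=> tE; pose f (z : dlim) := t _ (projT2 (repr z)).
have fE p (a : D p) : f (dlim_in a) = t p a.
  have [r [hr [hpr er]]] := repr_dlim_in a.
  by rewrite /f -(tE _ _ hr) er tE.
exists f; split.
  split=> // y z; have [q [b [c [-> ->]]]] := dlim_surj2 y z.
  by rewrite -raddfB !fE raddfB.
move=> g [_ gE]; apply/funext => z; have [q [b ->]] := dlim_surj z.
by rewrite fE gE.
Qed.

End DirectLimit.

(* [f] is the map induced on direct limits by a family of maps
   [u p q : D p -> E q] indexed by the morphisms (p, q) of Omega_k. *)
Definition is_dlim_map (k : nat) (D E : dsystem k)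
    (u : forall p q, p <=k q -> D p -> E q) (f : {additive dlim D -> dlim E}) :=
  forall p q (h : p <=k q) (a : D p), f (dlim_in a) = dlim_in (u p q h a).

(* [khom v w] is the set of morphisms with range [v] and source [w], so that
   composition [l m] is in the order of the arrows-only convention. *)
Record kgraph (k : nat) := KGraph {
  vert :> Type;
  khom : vert -> vert -> Type;
  kid : forall v, khom v v;
  kcomp : forall u v w, khom u v -> khom v w -> khom u w;
  kcompA : forall t u v w (f : khom t u) (g : khom u v) (h : khom v w),
    kcomp f (kcomp g h) = kcomp (kcomp f g) h;
  kcomp1f : forall v w (f : khom v w), kcomp (kid v) f = f;
  kcompf1 : forall v w (f : khom v w), kcomp f (kid w) = f;
  deg : forall v w, khom v w -> Nk k;
  deg_id : forall v, deg (kid v) = 0;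
  deg_comp : forall u v w (f : khom u v) (g : khom v w),
    deg (kcomp f g) = deg f + deg g;
  kcountable : countable [set: {vw : vert * vert & khom vw.1 vw.2}];
  kfactor : forall v w (l : khom v w) (m n : Nk k), deg l = m + n ->
    exists! t : {u : vert & (khom v u * khom u w)%type},
      [/\ l = kcomp (projT2 t).1 (projT2 t).2,
          deg (projT2 t).1 = m & deg (projT2 t).2 = n] }.

Section Paths.
Variables (k : nat) (L : kgraph k).

Definition row_finite_no_sources : Prop :=
  forall (m : Nk k) (v : L),
    let vLm := [set t : {w : L & khom v w} | deg (projT2 t) = m] in
    vLm !=set0 /\ finite_set vLm.

Definition morphism : Type := {vw : L * L & khom vw.1 vw.2}.
Definition mk_morphism (v w : L) (l : khom v w) : morphism := existT _ (v, w) l.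
Definition rng (l : morphism) : L := (projT1 l).1.
Definition src (l : morphism) : L := (projT1 l).2.
Definition degree (l : morphism) : Nk k := deg (projT2 l).

(* Degree-preserving functors Omega_k -> L. *)
Record ipath := IPath {
  ivert :> Nk k -> L;
  imor : forall p q, p <=k q -> khom (ivert p) (ivert q);
  imor_id : forall p (h : p <=k p), imor h = kid (ivert p);
  imor_comp : forall p q r (h : p <=k q) (h' : q <=k r) (h'' : p <=k r),
    imor h'' = kcomp (imor h) (imor h');
  imor_deg : forall p q (h : p <=k q), deg (imor h) = nk_sub q p }.

Definition cylinder (l : morphism) : set ipath :=
  [set x | mk_morphism (imor x (nk_le0 (degree l))) = l].

HB.instance Definition _ := gen_eqMixin ipath.
HB.instance Definition _ := gen_choiceMixin ipath.
HB.instance Definition _ :=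
  Topological.copy ipath (gen_space [set cylinder l | l in [set: morphism]]).

Lemma cylinder_src (l : morphism) (x : ipath) :
  cylinder l x -> src l = x (degree l).
Proof. by move=> e; rewrite -[in LHS]e. Qed.

Section Shift.
Variables (p : Nk k) (x : ipath).

Lemma shift_id m (h : m <=k m) : imor x (nk_le_add p h) = kid (x (m + p)).
Proof. exact: imor_id. Qed.

Lemma shift_comp m n r (h : m <=k n) (h' : n <=k r) (h'' : m <=k r) :
  imor x (nk_le_add p h'') = kcomp (imor x (nk_le_add p h)) (imor x (nk_le_add p h')).
Proof. exact: imor_comp. Qed.

Lemma shift_deg m n (h : m <=k n) : deg (imor x (nk_le_add p h)) = nk_sub n m.
Proof. by rewrite imor_deg; apply/ffunP => i; rewrite !ffunE subnDr. Qed.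

Definition shift : ipath := IPath shift_id shift_comp shift_deg.

End Shift.

Lemma ipath_eq (x y : ipath) :
  (forall p q (h : p <=k q), mk_morphism (imor x h) = mk_morphism (imor y h)) ->
  x = y.
Proof.
case: x => xv xm x1 x2 x3; case: y => yv ym y1 y2 y3 /= e.
have ev : xv = yv.
  by apply/funext => p; have := congr1 rng (e p p (nk_le_refl p)).
subst yv.
have em : xm = ym.
  apply: functional_extensionality_dep => p.
  apply: functional_extensionality_dep => q.
  apply: functional_extensionality_dep => h.
  exact: (@existT_inj2 {classic L * L} _ _ _ _ (e p q h)).
subst ym; congr IPath; exact: Prop_irrelevance.
Qed.

Lemma imor_cast (x : ipath) p q p' q' (h : p <=k q) (h' : p' <=k q') :
  p = p' -> q = q' -> mk_morphism (imor x h) = mk_morphism (imor x h').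
Proof. by move=> ep eq; subst p' q'; rewrite (bool_irrelevance h h'). Qed.

Lemma shift0 x : shift 0 x = x.
Proof.
apply: ipath_eq => p q h.
by apply: (imor_cast x (nk_le_add 0 h) h); rewrite addr0.
Qed.

Lemma shiftD p q x : shift p (shift q x) = shift (p + q) x.
Proof.
apply: ipath_eq => m n h.
by apply: (imor_cast x (nk_le_add q (nk_le_add p h)) (nk_le_add (p + q) h));
  rewrite addrA.
Qed.

Lemma shift_vertex p q x y : shift p x = shift q y -> y q = x p.
Proof. by move=> /(congr1 (fun z : ipath => z 0)) /=; rewrite !add0r. Qed.

(* [x = l z] *)
Definition is_concat (l : morphism) (z x : ipath) : Prop :=
  cylinder l x /\ shift (degree l) x = z.

End Paths.

Arguments ipath {k} L.
Arguments morphism {k} L.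

(* [garr x y] is the set of arrows with range [x] and source [y]. Continuity of
   the operations and etaleness play no role in the definition of a G-sheaf,
   so only the topologies are recorded. *)
Record groupoid := Groupoid {
  gunit :> topologicalType;
  garr : gunit -> gunit -> Type;
  garr_top : Topological {xy : gunit * gunit & garr xy.1 xy.2};
  gid : forall x, garr x x;
  gmul : forall x y z, garr x y -> garr y z -> garr x z;
  ginv : forall x y, garr x y -> garr y x;
  gmulA : forall x y z t (a : garr x y) (b : garr y z) (c : garr z t),
    gmul a (gmul b c) = gmul (gmul a b) c;
  gmul1g : forall x y (a : garr x y), gmul (gid x) a = a;
  gmulg1 : forall x y (a : garr x y), gmul a (gid y) = a;
  gmulgV : forall x y (a : garr x y), gmul a (ginv a) = gid x;
  gmulVg : forall x y (a : garr x y), gmul (ginv a) a = gid y }.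

Definition garrows (G : groupoid) : topologicalType := Topological.Pack (garr_top G).

(* The total space of a sheaf is the disjoint union of its stalks, and
   the projection to the base is [projT1]. *)
Record sheaf_data (X : topologicalType) := SheafData {
  stalk :> X -> zmodType;
  stalk_top : Topological {x : X & stalk x} }.

Definition total (X : topologicalType) (S : sheaf_data X) : topologicalType :=
  Topological.Pack (stalk_top S).

Section Sheaf.
Variables (X : topologicalType) (S : sheaf_data X).

Definition pt (x : X) (a : S x) : total S := existT _ x a.

Definition proj (e : total S) : X := projT1 e.

(* {(a, b) | proj a = proj b}, a subspace of the square of the total space *)
Definition fiber_square : Type := {x : X & (S x * S x)%type}.

Definition is_sheaf : Prop :=
  [/\ local_homeo proj,
      continuous_along
        (fun t : fiber_square => (pt (projT2 t).1, pt (projT2 t).2))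
        (fun t : fiber_square => pt ((projT2 t).1 + (projT2 t).2)),
      continuous (fun e : total S => pt (- projT2 e)) &
      continuous (fun x : X => pt (0 : S x))].

End Sheaf.

Record gsheaf_data (G : groupoid) := GSheafData {
  gsheaf_sheaf :> sheaf_data G;
  gact : forall x y : G, garr x y -> gsheaf_sheaf y -> gsheaf_sheaf x }.

Arguments gact {G} S {x y} g a : rename.

Section GSheaf.
Variables (G : groupoid) (S : gsheaf_data G).

(* {(g, a) | s(g) = proj a}, a subspace of arrows x total space *)
Definition act_domain : Type := {g : garrows G & S (projT1 g).2}.

Definition is_gsheaf : Prop :=
  is_sheaf S /\
  [/\ forall (x y : G) (g : garr x y),
        zmod_morphism (gact S g) /\ bijective (gact S g),
      forall (x : G) (a : S x), gact S (gid x) a = a,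
      forall (x y z : G) (g : garr x y) (h : garr y z) (a : S z),
        gact S g (gact S h a) = gact S (gmul g h) a &
      continuous_along
        (fun t : act_domain => (projT1 t, pt (projT2 t)))
        (fun t : act_domain => pt (gact S (projT2 (projT1 t)) (projT2 t)))].

End GSheaf.

Record gsheaf (G : groupoid) := GSheaf {
  gsheaf_val :> gsheaf_data G;
  gsheaf_ax : is_gsheaf gsheaf_val }.

Section GSheafCategory.
Variable G : groupoid.
Implicit Types S T U : gsheaf G.

Definition is_ghom S T (f : forall x, S x -> T x) : Prop :=
  [/\ forall x, zmod_morphism (f x),
      forall (x y : G) (g : garr x y) (a : S y), f x (gact S g a) = gact T g (f y a) &
      continuous (fun e : total S => pt (f _ (projT2 e)))].

Record ghom S T := GHom {
  ghom_fun :> forall x, S x -> T x;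
  ghom_ax : is_ghom ghom_fun }.

HB.instance Definition _ S T := gen_eqMixin (ghom S T).
HB.instance Definition _ S T := gen_choiceMixin (ghom S T).

Lemma ghom_eq S T (f g : ghom S T) : (forall x a, f x a = g x a) -> f = g.
Proof.
case: f g => f Hf [g Hg] /= e.
have efg : f = g.
  by apply: functional_extensionality_dep => x; apply/funext => a; apply: e.
by subst g; congr GHom; apply: Prop_irrelevance.
Qed.

Lemma total_cts S T (f : ghom S T) :
  continuous (fun e : total S => pt (f _ (projT2 e))).
Proof. by case: f => f []. Qed.

Lemma ghomB S T (f : ghom S T) x : zmod_morphism (f x).
Proof. by case: f => f []. Qed.

Lemma ghom_act S T (f : ghom S T) (x y : G) (g : garr x y) (a : S y) :
  f x (gact S g a) = gact T g (f y a).
Proof. by case: f => f []. Qed.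

HB.instance Definition _ S T (f : ghom S T) x :=
  GRing.isZmodMorphism.Build (S x) (T x) (f x) (@ghomB S T f x).

Lemma gactB S (x y : G) (g : garr x y) : zmod_morphism (gact S g).
Proof. by have [_ [/(_ x y g)[]]] := gsheaf_ax S. Qed.

HB.instance Definition _ S (x y : G) (g : garr x y) :=
  GRing.isZmodMorphism.Build (S y) (S x) (gact S g) (@gactB S x y g).

Lemma total_cts_add S T (f g : ghom S T) :
  continuous (fun e : total S => pt (f _ (projT2 e) + g _ (projT2 e))).
Proof.
have [[_ Tadd _ _] _] := gsheaf_ax T.
pose h (e : total S) : fiber_square T :=
  existT _ (projT1 e) (f _ (projT2 e), g _ (projT2 e)).
apply: (continuous_along_comp (h := h) Tadd) => e.
by apply: cvg_pair; apply: total_cts.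
Qed.

Lemma total_cts_opp S T (f : ghom S T) :
  continuous (fun e : total S => pt (- f _ (projT2 e))).
Proof.
have [[_ _ Topp _] _] := gsheaf_ax T => e.
apply: (@continuous_comp (total S) (total T) (total T)
  (fun e => pt (f _ (projT2 e))) (fun e => pt (- projT2 e)) e).
  exact: total_cts.
exact: Topp.
Qed.

Lemma total_cts_zero S T : continuous (fun e : total S => pt (0 : T (projT1 e))).
Proof.
have [[Sproj _ _ _] _] := gsheaf_ax S; have [[_ _ _ Tzero] _] := gsheaf_ax T => e.
apply: (@continuous_comp (total S) G (total T) (@proj G S)
  (fun x : G => pt (0 : T x)) e).
  exact: local_homeo_cts.
exact: Tzero.
Qed.

Lemma ghom_add_ax S T (f g : ghom S T) : is_ghom (fun x a => f x a + g x a).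
Proof.
split; last exact: total_cts_add.
- by move=> x a b; rewrite !raddfB opprD !addrA; congr (_ + _); rewrite addrAC.
- by move=> x y t a; rewrite !ghom_act -raddfD.
Qed.
Definition ghom_add S T (f g : ghom S T) := GHom (ghom_add_ax f g).

Lemma ghom_opp_ax S T (f : ghom S T) : is_ghom (fun x a => - f x a).
Proof.
split; last exact: total_cts_opp.
- by move=> x a b; rewrite raddfB opprD.
- by move=> x y t a; rewrite !ghom_act -raddfN.
Qed.
Definition ghom_opp S T (f : ghom S T) := GHom (ghom_opp_ax f).

Lemma ghom_zero_ax S T : is_ghom (fun x (_ : S x) => 0 : T x).
Proof.
split; last exact: total_cts_zero.
- by move=> x a b; rewrite subr0.
- by move=> x y t a; rewrite raddf0.
Qed.
Definition ghom_zero S T : ghom S T := GHom (@ghom_zero_ax S T).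

Lemma ghom_addA S T : associative (@ghom_add S T).
Proof. by move=> f g h; apply: ghom_eq => x a; rewrite /= addrA. Qed.

Lemma ghom_addC S T : commutative (@ghom_add S T).
Proof. by move=> f g; apply: ghom_eq => x a; rewrite /= addrC. Qed.

Lemma ghom_add0 S T : left_id (@ghom_zero S T) (@ghom_add S T).
Proof. by move=> f; apply: ghom_eq => x a; rewrite /= add0r. Qed.

Lemma ghom_addN S T : left_inverse (@ghom_zero S T) (@ghom_opp S T) (@ghom_add S T).
Proof. by move=> f; apply: ghom_eq => x a; rewrite /= addNr. Qed.

HB.instance Definition _ S T := GRing.isZmodule.Build (ghom S T)
  (@ghom_addA S T) (@ghom_addC S T) (@ghom_add0 S T) (@ghom_addN S T).

Lemma ghom_id_ax S : is_ghom (fun x (a : S x) => a).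
Proof.
split=> //; have -> : (fun e : total S => pt (projT2 e)) = id.
  by apply/funext => -[].
by move=> e; exact: cvg_id.
Qed.
Definition ghom_id S : ghom S S := GHom (ghom_id_ax S).

Lemma ghom_comp_ax S T U (g : ghom T U) (f : ghom S T) :
  is_ghom (fun x (a : S x) => g x (f x a)).
Proof.
split.
- by move=> x a b; rewrite !raddfB.
- by move=> x y t a; rewrite !ghom_act.
- move=> e.
  apply: (@continuous_comp (total S) (total T) (total U)
    (fun e => pt (f _ (projT2 e))) (fun e => pt (g _ (projT2 e))) e);
    exact: total_cts.
Qed.
Definition ghom_comp S T U (g : ghom T U) (f : ghom S T) : ghom S U :=
  GHom (ghom_comp_ax g f).

Definition gsheaf_cat : precat.
Proof.
refine (@PreCat (gsheaf G) (fun S T => ghom S T) ghom_id ghom_comp _ _ _ _ _).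
- by move=> *; apply: ghom_eq.
- by move=> *; apply: ghom_eq.
- by move=> *; apply: ghom_eq.
- by move=> *; apply: ghom_eq.
- by move=> A B C g f f'; apply: ghom_eq => x a /=; rewrite raddfD.
Defined.

End GSheafCategory.

Record rmod (k : nat) (L : kgraph k) := RMod {
  rmod_ob :> L -> zmodType;
  rmod_map : forall v w, khom v w -> {additive rmod_ob v -> rmod_ob w};
  rmod_id : forall v a, rmod_map (kid v) a = a;
  rmod_comp : forall u v w (f : khom u v) (g : khom v w) a,
    rmod_map (kcomp f g) a = rmod_map g (rmod_map f a) }.

Arguments rmod_map {k L} A {v w} l : rename.

Section RModCategory.
Variables (k : nat) (L : kgraph k).
Implicit Types A B C : rmod L.

Definition is_rhom A B (f : forall v, A v -> B v) : Prop :=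
  (forall v, zmod_morphism (f v)) /\
  forall v w (l : khom v w) (a : A v), f w (rmod_map A l a) = rmod_map B l (f v a).

Record rhom A B := RHom {
  rhom_fun :> forall v, A v -> B v;
  rhom_ax : is_rhom rhom_fun }.

HB.instance Definition _ A B := gen_eqMixin (rhom A B).
HB.instance Definition _ A B := gen_choiceMixin (rhom A B).

Lemma rhom_eq A B (f g : rhom A B) : (forall v a, f v a = g v a) -> f = g.
Proof.
case: f g => f Hf [g Hg] /= e.
have efg : f = g.
  by apply: functional_extensionality_dep => x; apply/funext => a; apply: e.
by subst g; congr RHom; apply: Prop_irrelevance.
Qed.

Lemma rhomB A B (f : rhom A B) v : zmod_morphism (f v).
Proof. by case: f => f []. Qed.

Lemma rhom_nat A B (f : rhom A B) v w (l : khom v w) (a : A v) :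
  f w (rmod_map A l a) = rmod_map B l (f v a).
Proof. by case: f => f []. Qed.

HB.instance Definition _ A B (f : rhom A B) v :=
  GRing.isZmodMorphism.Build (A v) (B v) (f v) (@rhomB A B f v).

Lemma rhom_add_ax A B (f g : rhom A B) : is_rhom (fun v a => f v a + g v a).
Proof.
split.
- by move=> x a b; rewrite !raddfB opprD !addrA; congr (_ + _); rewrite addrAC.
- by move=> v w l a; rewrite !rhom_nat -raddfD.
Qed.
Definition rhom_add A B (f g : rhom A B) := RHom (rhom_add_ax f g).

Lemma rhom_opp_ax A B (f : rhom A B) : is_rhom (fun v a => - f v a).
Proof.
split.
- by move=> v a b; rewrite raddfB opprD.
- by move=> v w l a; rewrite !rhom_nat -raddfN.
Qed.
Definition rhom_opp A B (f : rhom A B) := RHom (rhom_opp_ax f).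

Lemma rhom_zero_ax A B : is_rhom (fun v (_ : A v) => 0 : B v).
Proof.
split.
- by move=> v a b; rewrite subr0.
- by move=> v w l a; rewrite raddf0.
Qed.
Definition rhom_zero A B : rhom A B := RHom (@rhom_zero_ax A B).

Lemma rhom_addA A B : associative (@rhom_add A B).
Proof. by move=> f g h; apply: rhom_eq => v a; rewrite /= addrA. Qed.

Lemma rhom_addC A B : commutative (@rhom_add A B).
Proof. by move=> f g; apply: rhom_eq => v a; rewrite /= addrC. Qed.

Lemma rhom_add0 A B : left_id (@rhom_zero A B) (@rhom_add A B).
Proof. by move=> f; apply: rhom_eq => v a; rewrite /= add0r. Qed.

Lemma rhom_addN A B : left_inverse (@rhom_zero A B) (@rhom_opp A B) (@rhom_add A B).
Proof. by move=> f; apply: rhom_eq => v a; rewrite /= addNr. Qed.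

HB.instance Definition _ A B := GRing.isZmodule.Build (rhom A B)
  (@rhom_addA A B) (@rhom_addC A B) (@rhom_add0 A B) (@rhom_addN A B).

Lemma rhom_id_ax A : is_rhom (fun v (a : A v) => a).
Proof. by []. Qed.
Definition rhom_id A : rhom A A := RHom (rhom_id_ax A).

Lemma rhom_comp_ax A B C (g : rhom B C) (f : rhom A B) :
  is_rhom (fun v (a : A v) => g v (f v a)).
Proof.
split.
- by move=> v a b; rewrite !raddfB.
- by move=> v w l a; rewrite !rhom_nat.
Qed.
Definition rhom_comp A B C (g : rhom B C) (f : rhom A B) : rhom A C :=
  RHom (rhom_comp_ax g f).

Definition rmod_cat : precat.
Proof.
refine (@PreCat (rmod L) (fun A B => rhom A B) rhom_id rhom_comp _ _ _ _ _).
- by move=> *; apply: rhom_eq.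
- by move=> *; apply: rhom_eq.
- by move=> *; apply: rhom_eq.
- by move=> *; apply: rhom_eq.
- by move=> A B C g f f'; apply: rhom_eq => v a /=; rewrite raddfD.
Defined.

End RModCategory.

Section KerCoker.
Variables (V W : zmodType) (f : {additive V -> W}).

Definition ker_of : Type := {a : V | f a = 0}.
HB.instance Definition _ := gen_eqMixin ker_of.
HB.instance Definition _ := gen_choiceMixin ker_of.

Lemma ker_eq (a b : ker_of) : sval a = sval b -> a = b.
Proof.
by case: a b => [a ha] [b hb] /= e; subst b; congr exist; apply: Prop_irrelevance.
Qed.

Lemma ker_addP (a b : ker_of) : f (sval a + sval b) = 0.
Proof. by rewrite raddfD (svalP a) (svalP b) addr0. Qed.
Lemma ker_oppP (a : ker_of) : f (- sval a) = 0.
Proof. by rewrite raddfN (svalP a) oppr0. Qed.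

Definition ker_add (a b : ker_of) : ker_of := exist _ _ (ker_addP a b).
Definition ker_opp (a : ker_of) : ker_of := exist _ _ (ker_oppP a).
Definition ker_zero : ker_of := exist _ 0 (raddf0 f).

Lemma ker_addA : associative ker_add.
Proof. by move=> a b c; apply: ker_eq; rewrite /= addrA. Qed.
Lemma ker_addC : commutative ker_add.
Proof. by move=> a b; apply: ker_eq; rewrite /= addrC. Qed.
Lemma ker_add0 : left_id ker_zero ker_add.
Proof. by move=> a; apply: ker_eq; rewrite /= add0r. Qed.
Lemma ker_addN : left_inverse ker_zero ker_opp ker_add.
Proof. by move=> a; apply: ker_eq; rewrite /= addNr. Qed.
HB.instance Definition _ :=
  GRing.isZmodule.Build ker_of ker_addA ker_addC ker_add0 ker_addN.

Definition coker_eq (b c : W) : bool := `[< exists a, b - c = f a >].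

Lemma coker_refl : reflexive coker_eq.
Proof. by move=> b; apply/asboolP; exists 0; rewrite raddf0 subrr. Qed.
Lemma coker_sym : symmetric coker_eq.
Proof.
by move=> b c; apply/asboolP/asboolP => -[a e]; exists (- a);
  rewrite raddfN -e opprB.
Qed.
Lemma coker_trans : transitive coker_eq.
Proof.
move=> c b d /asboolP[a e] /asboolP[a' e']; apply/asboolP; exists (a + a').
by rewrite raddfD -e -e' addrA subrK.
Qed.
Definition coker_equiv := EquivRel coker_eq coker_refl coker_sym coker_trans.

Definition coker_of : Type := {eq_quot coker_equiv}.
HB.instance Definition _ := Choice.on coker_of.
HB.instance Definition _ := EqQuotient.on coker_of.

Definition coker_pi (b : W) : coker_of := \pi_coker_of b.

Lemma coker_piP b c : coker_pi b = coker_pi c <-> exists a, b - c = f a.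
Proof.
split; first by move=> /eqmodP /asboolP.
by move=> h; apply/eqmodP/asboolP.
Qed.

Lemma coker_surj (y : coker_of) : exists b, y = coker_pi b.
Proof. by exists (repr y); rewrite /coker_pi reprK. Qed.

Lemma coker_repr b : exists a, repr (coker_pi b) - b = f a.
Proof. by apply/coker_piP; rewrite /coker_pi reprK. Qed.

Definition coker_add (y z : coker_of) := coker_pi (repr y + repr z).
Definition coker_opp (y : coker_of) := coker_pi (- repr y).

Lemma coker_addE b c : coker_add (coker_pi b) (coker_pi c) = coker_pi (b + c).
Proof.
have [a ha] := coker_repr b; have [a' ha'] := coker_repr c.
by apply/coker_piP; exists (a + a'); rewrite raddfD -ha -ha' opprD addrACA.
Qed.
Lemma coker_oppE b : coker_opp (coker_pi b) = coker_pi (- b).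
Proof.
have [a ha] := coker_repr b; apply/coker_piP; exists (- a).
by rewrite raddfN -ha opprB opprK addrC.
Qed.

Lemma coker_addA : associative coker_add.
Proof.
move=> x y z; have [b ->] := coker_surj x; have [c ->] := coker_surj y.
by have [d ->] := coker_surj z; rewrite !coker_addE addrA.
Qed.
Lemma coker_addC : commutative coker_add.
Proof. by move=> x y; rewrite /coker_add addrC. Qed.
Lemma coker_add0 : left_id (coker_pi 0) coker_add.
Proof. by move=> x; have [b ->] := coker_surj x; rewrite coker_addE add0r. Qed.
Lemma coker_addN : left_inverse (coker_pi 0) coker_opp coker_add.
Proof.
by move=> x; have [b ->] := coker_surj x; rewrite coker_oppE coker_addE addNr.
Qed.
HB.instance Definition _ :=
  GRing.isZmodule.Build coker_of coker_addA coker_addC coker_add0 coker_addN.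

Lemma coker_piB : zmod_morphism coker_pi.
Proof. by move=> b c; rewrite -coker_addE -coker_oppE. Qed.
HB.instance Definition _ := GRing.isZmodMorphism.Build W coker_of coker_pi coker_piB.

Lemma coker_pi0 b : coker_pi b = 0 <-> exists a, b = f a.
Proof. by rewrite coker_piP subr0. Qed.

End KerCoker.

Section RModExact.
Variables (k : nat) (L : kgraph k).
Implicit Types A B C : rmod L.

Section Kernel.
Variables (A B : rmod L) (f : rhom A B).

Definition kmod_fun v w (l : khom v w) (a : ker_of (f v)) : ker_of (f w).
Proof.
exists (rmod_map A l (sval a)).
apply: etrans (rhom_nat f l (sval a)) _.
exact: etrans (congr1 (rmod_map B l) (svalP a)) (raddf0 _).
Defined.

Lemma kmod_funB v w (l : khom v w) : zmod_morphism (kmod_fun l).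
Proof. by move=> a b; apply: ker_eq; rewrite /= raddfB. Qed.
HB.instance Definition _ v w (l : khom v w) :=
  GRing.isZmodMorphism.Build _ _ (kmod_fun l) (@kmod_funB v w l).

Definition kmod : rmod L.
Proof.
refine (@RMod k L (fun v => ker_of (f v)) (fun v w l => kmod_fun l) _ _).
- by move=> v a; apply: ker_eq; rewrite /= rmod_id.
- by move=> u v w g h a; apply: ker_eq; rewrite /= rmod_comp.
Defined.

Definition kmod_in : rhom kmod A.
Proof. by exists (fun v (a : ker_of (f v)) => sval a). Defined.

Lemma kmod_kernel : @is_kernel (rmod_cat L) _ _ _ f kmod_in.
Proof.
split; first by apply: rhom_eq => v a /=; rewrite (svalP a).
move=> T h fh0.
have hP v (t : T v) : f v ((h : rhom T A) v t) = 0.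
  exact: (congr1 (fun u : rhom T B => u v t) fh0).
have ax : @is_rhom k L T kmod (fun v t => exist _ _ (hP v t)).
  split; first by move=> v a b; apply: ker_eq; rewrite /= raddfB.
  by move=> v w l a; apply: ker_eq; rewrite /= rhom_nat.
exists (RHom ax); split; first exact: rhom_eq.
move=> u uh; apply: rhom_eq => v t; apply: ker_eq => /=.
by rewrite -[h]uh.
Qed.

Definition qmod_fun v w (l : khom v w) (y : coker_of (f v)) : coker_of (f w) :=
  coker_pi (f w) (rmod_map B l (repr y)).

Lemma qmod_funE v w (l : khom v w) b :
  qmod_fun l (coker_pi (f v) b) = coker_pi (f w) (rmod_map B l b).
Proof.
have [a ha] := coker_repr (f v) b; apply/coker_piP.
exists (rmod_map A l a); rewrite -raddfB ha.
exact: esym (rhom_nat f l a).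
Qed.

Lemma qmod_funB v w (l : khom v w) : zmod_morphism (qmod_fun l).
Proof.
move=> y z; have [b ->] := coker_surj y; have [c ->] := coker_surj z.
by rewrite -raddfB !qmod_funE -raddfB -raddfB.
Qed.
HB.instance Definition _ v w (l : khom v w) :=
  GRing.isZmodMorphism.Build _ _ (qmod_fun l) (@qmod_funB v w l).

Definition qmod : rmod L.
Proof.
refine (@RMod k L (fun v => coker_of (f v)) (fun v w l => qmod_fun l) _ _).
- by move=> v y; have [b ->] := coker_surj y; rewrite /= qmod_funE rmod_id.
- move=> u v w g h y; have [b ->] := coker_surj y.
  by rewrite /= !qmod_funE rmod_comp.
Defined.

Definition qmod_pi : rhom B qmod.
Proof.
exists (fun v => coker_pi (f v)); split; first by move=> v; exact: coker_piB.
by move=> v w l b /=; rewrite qmod_funE.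
Defined.

Lemma qmod_cokernel : @is_cokernel (rmod_cat L) _ _ _ f qmod_pi.
Proof.
split.
  by apply: rhom_eq => v a; apply/coker_pi0; exists a.
move=> T h hf0.
have hP v (a : A v) : (h : rhom B T) v (f v a) = 0.
  exact: (congr1 (fun u : rhom A T => u v a) hf0).
pose u v (y : coker_of (f v)) : T v := (h : rhom B T) v (repr y).
have uE v b : u v (coker_pi (f v) b) = (h : rhom B T) v b.
  have [a ha] := coker_repr (f v) b; apply/subr0_eq.
  by apply: etrans (hP v a); rewrite -ha raddfB.
have ax : @is_rhom k L qmod T u.
  split.
    move=> v y z; have [b ->] := coker_surj y; have [c ->] := coker_surj z.
    by rewrite -raddfB !uE raddfB.
  move=> v w l y; have [b ->] := coker_surj y.
  by rewrite /= qmod_funE !uE rhom_nat.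
exists (RHom ax); split; first by apply: rhom_eq => v b; apply: uE.
move=> u' uh; apply: rhom_eq => v y; have [b ->] := coker_surj y.
by rewrite /= uE -[h]uh.
Qed.

End Kernel.

(* Exactness in the category of right modules is exactness at each object. *)
Lemma rmod_exactP A B C (f : rhom A B) (g : rhom B C) :
  @exact_at (rmod_cat L) A B C f g <->
  forall v (b : B v), g v b = 0 <-> exists a : A v, b = f v a.
Proof.
split.
  move=> [Q [c [K [i [[cf0 cU] [ci0 iU] [gi0 gU]]]]]] v b; split.
    move=> gb0.
    have [u [iu _]] := gU _ (kmod_in g) (kmod_kernel g).1.
    have [w [wc _]] := cU _ (qmod_pi f) (qmod_cokernel f).1.
    have ib : b = (i : rhom K B) v ((u : rhom (kmod g) K) v (exist _ b gb0)).
      exact: esym (congr1 (fun t : rhom (kmod g) B => t v (exist _ b gb0)) iu).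
    have cb0 : (c : rhom B Q) v b = 0.
      rewrite ib; exact: (congr1 (fun t : rhom K Q => t v _) ci0).
    apply/coker_pi0.
    transitivity ((w : rhom Q (qmod f)) v ((c : rhom B Q) v b)).
      exact: esym (congr1 (fun t : rhom B (qmod f) => t v b) wc).
    by rewrite cb0 raddf0.
  move=> [a ->]; have [u [iu _]] := iU _ f cf0.
  have -> : f v a = (i : rhom K B) v ((u : rhom A K) v a).
    exact: esym (congr1 (fun t : rhom A B => t v a) iu).
  exact: (congr1 (fun t : rhom K C => t v _) gi0).
move=> fg; exists (qmod f), (qmod_pi f), (kmod (qmod_pi f)), (kmod_in (qmod_pi f)).
split; [exact: qmod_cokernel|exact: kmod_kernel|].
have cg v (b : B v) : coker_pi (f v) b = 0 <-> g v b = 0.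
  by rewrite coker_pi0 fg.
split; first by apply: rhom_eq => v a; apply/cg; exact: (svalP a).
move=> T h gh0.
have ch0 : @ccomp (rmod_cat L) _ _ _ (qmod_pi f) h = 0.
  apply: rhom_eq => v t; apply/cg.
  exact: (congr1 (fun u : rhom T C => u v t) gh0).
exact: ((kmod_kernel (qmod_pi f)).2 T h ch0).
Qed.

End RModExact.

Section PathGroupoid.
Variables (k : nat) (L : kgraph k).
Implicit Types x y z : ipath L.

Definition path_arr x y : Type :=
  {n : Zk k | exists j l, n = nk_int j - nk_int l /\ shift j x = shift l y}.

Definition path_arrows : Type := {xy : ipath L * ipath L & path_arr xy.1 xy.2}.

(* Z(l, m) *)
Definition bicylinder (l m : morphism L) : set path_arrows :=
  [set g | sval (projT2 g) = nk_int (degree l) - nk_int (degree m) /\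
     exists z, is_concat l z (projT1 g).1 /\ is_concat m z (projT1 g).2].

Definition path_arr_top : Topological path_arrows :=
  gen_topology [set U | exists l m, src l = src m /\ U = bicylinder l m].

Lemma path_id_ax x :
  exists j l, 0 = nk_int j - nk_int l /\ shift j x = shift l x.
Proof. by exists 0, 0; rewrite subrr. Qed.
Definition path_id x : path_arr x x := exist _ 0 (path_id_ax x).

Lemma path_mul_ax x y z (g : path_arr x y) (h : path_arr y z) :
  exists j l, sval g + sval h = nk_int j - nk_int l /\ shift j x = shift l z.
Proof.
case: g h => [m [j [l [em e]]]] [n [j' [l' [en e']]]] /=; rewrite em en.
exists (j' + j), (l + l'); split; last first.
  by rewrite -(shiftD j' j) e shiftD (addrC j') -(shiftD l j') e' shiftD.
by rewrite !nk_intD opprD addrACA [nk_int j + nk_int j']addrC.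
Qed.
Definition path_mul x y z (g : path_arr x y) (h : path_arr y z) : path_arr x z :=
  exist _ (sval g + sval h) (path_mul_ax g h).

Lemma path_inv_ax x y (g : path_arr x y) :
  exists j l, - sval g = nk_int j - nk_int l /\ shift j y = shift l x.
Proof. by case: g => [m [j [l [em e]]]]; exists l, j; rewrite /= em opprB. Qed.
Definition path_inv x y (g : path_arr x y) : path_arr y x :=
  exist _ (- sval g) (path_inv_ax g).

Lemma path_arr_eq x y (g h : path_arr x y) : sval g = sval h -> g = h.
Proof.
by case: g h => [m hm] [n hn] /= e; subst n; congr exist; apply: Prop_irrelevance.
Qed.

Definition path_groupoid : groupoid.
Proof.
refine (@Groupoid (ipath L) path_arr path_arr_top path_id path_mul path_inv _ _ _ _ _).
- by move=> *; apply: path_arr_eq; rewrite /= addrA.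
- by move=> *; apply: path_arr_eq; rewrite /= add0r.
- by move=> *; apply: path_arr_eq; rewrite /= addr0.
- by move=> *; apply: path_arr_eq; rewrite /= subrr.
- by move=> *; apply: path_arr_eq; rewrite /= addNr.
Defined.

End PathGroupoid.

Section Underline.
Variables (k : nat) (L : kgraph k) (A : rmod L).

Lemma path_sys_id (x : ipath L) p (h : p <=k p) a : rmod_map A (imor x h) a = a.
Proof. by rewrite imor_id rmod_id. Qed.

Lemma path_sys_comp (x : ipath L) p q r
    (h : p <=k q) (h' : q <=k r) (h'' : p <=k r) a :
  rmod_map A (imor x h'') a = rmod_map A (imor x h') (rmod_map A (imor x h) a).
Proof. by rewrite (imor_comp x h h' h'') rmod_comp. Qed.

Definition path_sys (x : ipath L) : dsystem k :=
  @DSystem k (fun p => A (x p)) (fun p q h => rmod_map A (imor x h))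
    (@path_sys_id x) (@path_sys_comp x).

Definition ulstalk (x : ipath L) : zmodType := dlim (path_sys x).

Definition germ (x : ipath L) (p : Nk k) (a : A (x p)) : ulstalk x :=
  @dlim_in k (path_sys x) p a.

Definition transport (v w : L) (e : v = w) (a : A v) : A w :=
  eq_rect v (fun v => A v) a w e.

Definition germ_set (l : morphism L) (a : A (src l)) :
    set {x : ipath L & ulstalk x} :=
  [set e | exists (y : ipath L) (hy : cylinder l y),
     e = existT _ y (germ (transport (cylinder_src hy) a))].

Definition ulsheaf : sheaf_data (ipath L) :=
  @SheafData _ ulstalk
    (gen_topology [set U | exists (l : morphism L) (a : A (src l)), U = germ_set a]).

Definition path_action : Type :=
  forall x y : ipath L, path_arr x y -> ulstalk y -> ulstalk x.

(* Every germ over [y] is of the form [germ b] with [b] at level [q], [q]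
   arbitrarily large, so these equations determine the action. *)
Definition is_path_action (alpha : path_action) : Prop :=
  forall (x y : ipath L) (g : path_arr x y) (p q : Nk k)
      (h : shift p x = shift q y),
    nk_int p = sval g + nk_int q ->
    forall b : A (y q),
      alpha x y g (germ b) = germ (transport (shift_vertex h) b).

Definition ulgsheaf (alpha : path_action) : gsheaf_data (path_groupoid L) :=
  @GSheafData (path_groupoid L) ulsheaf alpha.

End Underline.

(* Main.v *)
Require Import Defs.
From HB Require Import structures.
From mathcomp Require Import all_boot all_order all_algebra.
From mathcomp Require Import finmap all_classical topology.

Set Implicit Arguments.
Unset Strict Implicit.
Unset Printing Implicit Defensive.

Import GRing.Theory.
Local Open Scope classical_set_scope.
Local Open Scope ring_scope.

(** The stalks of the underlined sheaf are filtered colimits, so every statement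
    about finitely many of their elements can be moved to one common degree [r],
    where it becomes a statement about the groups [A (x r)]. This settles the
    additivity and the functoriality of the construction, and stalkwise
    exactness ([ul_map_exact]): a germ killed by [g] is killed at some finite
    degree already, and there exactness of modules applies.

    For the topology, unique factorization shows that two infinite paths with
    the same initial segment of degree [r] agree on all of the cube [0, r]
    ([seg_imor]). Hence an equality of germs over [x], which is witnessed at
    some degree [r], persists over the whole cylinder of paths that share
    [x(0, r)]. This is [germ_nbhd_refine], which makes the sets [germ_set] a
    basis and reduces every continuity statement to raising a representative
    to a degree at which the wanted equality holds on the nose.

    The action transports a germ along [shift p x = shift q y]. Two choices of
    [p] and [q] for the same arrow differ by a common translation, so they
    agree once both are raised far enough ([germ_shift]); composition of arrows
    is composition of transports at a common degree.

    Exactness of the functor means exactness in the categorical sense, through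
    universal properties of kernels and cokernels. Since a morphism of sheaves
    is an open map ([ghom_open]), a morphism defined stalkwise through an
    injective or a surjective one is automatically continuous; so kernels and
    cokernels of equivariant sheaves are recognized on stalks ([ghom_kernel],
    [ghom_cokernel]). The kernel and the cokernel of module morphisms are thus
    sent to a kernel and a cokernel of sheaf morphisms, which witness
    exactness. *)

(* Notions of the same names in the imported libraries hide these two. *)
Local Notation total := Defs.total.
Local Notation proj := Defs.proj.

(** * Bases of generated topologies *)

Lemma gen_open (T : Type) (B : set (set T)) (b : set T) :
  B b -> open (b : set (Topological.Pack (gen_topology B))).
Proof.
move=> Bb; exists [set b]; last by rewrite bigcup_set1.
move=> _ ->; exists [fset b]%fset; first by move=> i /fset1P ->; exact/mem_set.
by apply/predeqP => t; split=> [|bt i /fset1P -> //]; apply; exact/fset1P.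
Qed.

(** Open sets are unions of finite intersections of members of [B], and the
    pairwise condition iterates to finite intersections; the empty
    intersection is what the covering condition is for. *)
Lemma gen_basis (T : Type) (B : set (set T)) :
    (forall t, exists2 b, B b & b t) ->
    (forall b c t, B b -> B c -> b t -> c t ->
       exists2 d, B d & d t /\ d `<=` b `&` c) ->
  basis (B : set (set (Topological.Pack (gen_topology B)))).
Proof.
move=> Bcov Bmeet; split; first by move=> b; exact: gen_open.
move=> t V; rewrite nbhsE => -[W [oW Wt] WV].
have [F Ffin FW] : exists2 F, F `<=` finI_from B id & \bigcup_(b in F) b = W := oW.
move: Wt; rewrite -FW => -[b Fb bt].
have [D DB bE] := Ffin _ Fb.
have {}bt i : i \in enum_fset D -> B i /\ i t.
  by move=> iD; split; [exact/set_mem/DB|move: bt; rewrite -bE; apply].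
suff [d Bd [dt dD]] :
    exists2 d, B d & d t /\ forall i, i \in enum_fset D -> d `<=` i.
  exists d => //; apply: subset_trans WV => s ds; rewrite -FW.
  by exists b => //; rewrite -bE => i iD; exact: dD iD _ ds.
elim: (enum_fset D) bt => [|i s IHs] bt.
  by have [d Bd dt] := Bcov t; exists d.
have [j js|d Bd [dt ds]] := IHs.
  by apply: bt; rewrite inE js orbT.
have [Bi it] := bt i (mem_head _ _).
have [c Bc [ct cdi]] := Bmeet d i t Bd Bi dt it.
exists c => //; split=> // j; rewrite inE => /orP[/eqP ->|js].
  by apply: subset_trans cdi _ => u [].
by apply: subset_trans (ds j js) => u /cdi[].
Qed.

Lemma basis_nbhs (X : topologicalType) (B : set (set X)) (x : X) (V : set X) :
  basis B -> nbhs x V -> exists2 b, B b & b x /\ b `<=` V.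
Proof. by move=> [_ Bx] /(Bx x)[b [Bb bx] bV]; exists b. Qed.

Lemma basis_open_nbhs (X : topologicalType) (B : set (set X)) (b : set X) (x : X) :
  basis B -> B b -> b x -> nbhs x b.
Proof. by move=> [Bo _] Bb bx; apply: open_nbhs_nbhs; split=> //; exact: Bo. Qed.

Lemma basis_continuous (X Y : topologicalType) (B : set (set Y)) (f : X -> Y) :
  basis B ->
  (forall x b, B b -> b (f x) -> exists2 W, nbhs x W & W `<=` f @^-1` b) ->
  continuous f.
Proof.
move=> BB Bf x V /(basis_nbhs BB)[b Bb [bfx bV]].
have [W Wx Wb] := Bf x b Bb bfx.
by apply: filterS Wx => y /Wb /bV.
Qed.

Lemma continuous_along_basis (D : Type) (X Y : topologicalType)
    (B : set (set Y)) (j : D -> X) (f : D -> Y) :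
  basis B ->
  (forall t b, B b -> b (f t) ->
     exists2 W, nbhs (j t) W & j @^-1` W `<=` f @^-1` b) ->
  continuous_along j f.
Proof.
move=> BB Bf; apply: (basis_continuous BB) => t b Bb bft.
have [W Wj Wb] := Bf t b Bb bft.
by exists (j @^-1` W) => //; exact: (initial_continuous Wj).
Qed.

Lemma open_imageP (X Y : topologicalType) (f : X -> Y) (V : set X) :
  (forall x, V x -> nbhs (f x) (f @` V)) -> open (f @` V).
Proof. by move=> fV; rewrite openE => _ [x Vx <-]; exact: fV. Qed.

(** * Kernels and cokernels of equivariant sheaves *)

Section SheafMorphisms.
Variable G : groupoid.
Implicit Types S T U : gsheaf G.

(** Near [F e] the target is a sheet: a point is determined by its projection.
    If [g] is a section of the source through [e], then [F \o g \o proj] is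
    continuous near [F e] and lands in that sheet, hence it is the identity
    there, and its values lie in the image of [V] as soon as [g \o proj] has
    values in [V]. *)
Lemma ghom_open S T (f : ghom S T) (V : set (total S)) :
  open V -> open ((fun e : total S => pt (f _ (projT2 e))) @` V).
Proof.
set F := (X in X @` _); move=> oV; apply: open_imageP => e Ve.
have [[Sloc _ _ _] _] := gsheaf_ax S; have [[Tloc _ _ _] _] := gsheaf_ax T.
have [U [g [[oU Ue oP] [_ cg gK]]]] := Sloc e.
have [U' [g' [[oU' Ue' _] [_ _ g'K]]]] := Tloc (F e).
have gP : g (proj e) = e by apply: gK; rewrite inE.
have Pe : nbhs (proj (F e)) (proj (S := S) @` U).
  by apply: open_nbhs_nbhs; split=> //; exists e.
have cge : {for proj (F e), continuous g}.
  move: cg; rewrite continuous_open_subspace // => /(_ (proj (F e))); apply.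
  by rewrite inE; exists e.
have cgp : {for F e, continuous (g \o proj (S := T))}.
  by apply: continuous_comp => //; exact: local_homeo_cts Tloc _.
have cF : continuous F by exact: total_cts.
have gFe : (g \o proj (S := T)) (F e) = e by [].
have nV : nbhs (F e) ((g \o proj (S := T)) @^-1` V).
  by apply: cgp; rewrite gFe; exact: open_nbhs_nbhs.
have nU' : nbhs (F e) ((F \o (g \o proj (S := T))) @^-1` U').
  apply: (continuous_comp cgp (cF _)).
  rewrite -[_ (F e)]/(F ((g \o proj (S := T)) (F e))) gFe.
  exact: open_nbhs_nbhs.
have nP : nbhs (F e) (proj (S := T) @^-1` (proj (S := S) @` U)).
  exact: (local_homeo_cts Tloc).
have nU : nbhs (F e) U' by exact: open_nbhs_nbhs.
near=> t.
have Vt : V (g (proj t)) by near: t.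
exists (g (proj t)) => //.
have pF u : proj (F u) = proj u by [].
have pgt : proj (g (proj t)) = proj t.
  have [u Uu <-] : (proj (S := S) @` U) (proj t) by near: t.
  have gu : g (proj u) = u by apply: gK; rewrite inE.
  by rewrite gu.
have U'F : U' (F (g (proj t))) by near: t.
have U't : U' t by near: t.
have {}g'K u : U' u -> g' (proj u) = u by move=> U'u; apply: g'K; rewrite inE.
by rewrite -[LHS]g'K // pF pgt g'K.
Unshelve. all: end_near.
Qed.

(** A morphism [h] with [f h = 0] factors through [i] stalk by stalk; the factor
    is continuous because [i] is open and injective, so that preimages under the
    factor are preimages under [h] of images under [i]. *)
Lemma ghom_kernel K S T (i : ghom K S) (f : ghom S T) :
    (forall x, injective (i x)) ->
    (forall x a, f x a = 0 <-> exists b, a = i x b) ->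
  @is_kernel (gsheaf_cat G) K S T f i.
Proof.
move=> i_inj ker_f; split.
  by apply: ghom_eq => x b; apply/ker_f; exists b.
move=> R h fh0.
have hP x r : exists b, (h : ghom R S) x r = i x b.
  by apply/ker_f; exact: (congr1 (fun u : ghom R T => u x r) fh0).
pose u x r : K x := sval (cid (hP x r)).
have uE x r : i x (u x r) = (h : ghom R S) x r.
  exact/esym/(svalP (cid (hP x r))).
have u_ax : is_ghom (S := R) (T := K) u.
  split.
  - by move=> x r s; apply: (i_inj x); rewrite raddfB /= !uE raddfB.
  - by move=> x y g r; apply: (i_inj x); rewrite uE !ghom_act uE.
  - apply/continuousP => V oV.
    have -> : (fun e : total R => pt (u _ (projT2 e))) @^-1` V =
        (fun e : total R => pt ((h : ghom R S) _ (projT2 e))) @^-1`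
          ((fun e : total K => pt (i _ (projT2 e))) @` V).
      apply/predeqP => -[x r]; split=> /= [Vu|[[y b] Vb e]].
        by exists (pt (u x r)) => //=; rewrite uE.
      have xy : y = x by exact: (congr1 (@projT1 _ _) e).
      subst y; have {}e := existT_inj2 e; rewrite -uE in e.
      by rewrite -(i_inj _ _ _ e).
    by move/continuousP: (@total_cts _ _ _ (h : ghom R S)); apply; exact: ghom_open.
exists (GHom u_ax); split; first by apply: ghom_eq => x r; exact: uE.
move=> u' iu'; apply: ghom_eq => x r; apply: (i_inj x) => /=.
by rewrite uE -[h]iu'.
Qed.

(** A morphism [h] with [h f = 0] descends along [c] stalk by stalk; the descended
    map is continuous because [c] is open and onto, so that preimages under it
    are images under [c] of preimages under [h]. *)
Lemma ghom_cokernel S T Q (f : ghom S T) (c : ghom T Q) :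
    (forall x q, exists b, q = c x b) ->
    (forall x b, c x b = 0 <-> exists a, b = f x a) ->
  @is_cokernel (gsheaf_cat G) S T Q f c.
Proof.
move=> c_surj ker_c; split.
  by apply: ghom_eq => x a; apply/ker_c; exists a.
move=> R h hf0.
pose u x q : R x := (h : ghom T R) x (sval (cid (c_surj x q))).
have uE x b : u x (c x b) = (h : ghom T R) x b.
  rewrite /u; case: cid => b' /= /esym e.
  have [|a ab] := (ker_c x (b' - b)).1; first by rewrite raddfB /= e subrr.
  apply/subr0_eq; rewrite -raddfB ab.
  exact: (congr1 (fun v : ghom S R => v x a) hf0).
have u_ax : is_ghom (S := Q) (T := R) u.
  split.
  - move=> x q r; have [b ->] := c_surj x q; have [d ->] := c_surj x r.
    by rewrite -raddfB !uE raddfB.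
  - move=> x y g q; have [b ->] := c_surj y q.
    by rewrite -ghom_act !uE ghom_act.
  - apply/continuousP => V oV.
    have -> : (fun e : total Q => pt (u _ (projT2 e))) @^-1` V =
        (fun e : total T => pt (c _ (projT2 e))) @`
          ((fun e : total T => pt ((h : ghom T R) _ (projT2 e))) @^-1` V).
      apply/predeqP => -[x q]; split=> [|[[y b] Vh <-]]; last by rewrite /= uE.
      rewrite /=; have [b ->] := c_surj x q; rewrite uE => Vh.
      by exists (pt b).
    by apply: ghom_open; move/continuousP: (@total_cts _ _ _ (h : ghom T R)); apply.
exists (GHom u_ax); split; first by apply: ghom_eq => x b; exact: uE.
move=> u' uc'; apply: ghom_eq => x q; have [b ->] := c_surj x q.
by rewrite /= uE -[h]uc'.
Qed.

End SheafMorphisms.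

(** * Initial segments of infinite paths *)

Section Segments.
Variables (k : nat) (L : kgraph k).
Implicit Types (x y : ipath L) (l m n p q r : Nk k).

Lemma nk_le_addr p q : p <=k q + p.
Proof. by apply/nk_leP => i; rewrite ffunE leq_addl. Qed.

Lemma nk_subK p q : p <=k q -> nk_sub q p + p = q.
Proof. by move=> /nk_leP h; apply/ffunP => i; rewrite !ffunE; apply: subnK. Qed.

Lemma nk_int_inj : injective (@nk_int k).
Proof.
by move=> p q /ffunP e; apply/ffunP => i; have := e i; rewrite !ffunE => -[].
Qed.

Lemma nk_int_sub p q : q <=k p -> nk_int (nk_sub p q) = nk_int p - nk_int q.
Proof. by move=> /nk_subK {2}<-; rewrite nk_intD addrK. Qed.

Lemma nk_int_raise p q r (n : Zk k) : nk_int p = n + nk_int q -> q <=k r ->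
  nk_int (nk_sub r q + p) = n + nk_int r.
Proof. by move=> pq qr; rewrite nk_intD nk_int_sub // pq addrCA subrK. Qed.

Lemma mk_morphism_inj (v w : L) : injective (@mk_morphism k L v w).
Proof. by move=> f g; exact: (@existT_inj2 {classic L * L}). Qed.

(** Unique factorization, phrased for the total type of morphisms: the two
    factorizations of one morphism need not pass through syntactically the same
    vertices. *)
Lemma kcomp_cancel (u v w u' v' w' : L) (f : khom u v) (g : khom v w)
    (f' : khom u' v') (g' : khom v' w') :
    mk_morphism (kcomp f g) = mk_morphism (kcomp f' g') ->
    deg f = deg f' -> deg g = deg g' ->
  mk_morphism f = mk_morphism f' /\ mk_morphism g = mk_morphism g'.
Proof.
move=> e; have eu : u = u' := congr1 (@rng k L) e.
have ew : w = w' := congr1 (@src k L) e; subst u' w'.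
move/mk_morphism_inj: e => e ef eg.
have [t [_ tP]] := kfactor (deg_comp f g).
have e1 := tP (existT _ v (f, g)) (And3 erefl erefl erefl).
have e2 := tP (existT _ v' (f', g')) (And3 e (esym ef) (esym eg)).
split.
  exact: (congr1 (fun s => mk_morphism (projT2 s).1) (etrans (esym e1) e2)).
exact: (congr1 (fun s => mk_morphism (projT2 s).2) (etrans (esym e1) e2)).
Qed.

Definition seg x p : morphism L := mk_morphism (imor x (nk_le0 p)).

Lemma degree_seg x p : degree (seg x p) = p.
Proof. by rewrite /degree imor_deg; apply/ffunP => i; rewrite !ffunE subn0. Qed.

(** Cancel first the tail [x(n, p)] and then the head [x(0, m)] of [x(0, p)]. *)
Lemma seg_imor x y p m n (h : m <=k n) : n <=k p -> seg x p = seg y p ->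
  mk_morphism (imor x h) = mk_morphism (imor y h).
Proof.
move=> np exy; have split_seg z q r (qr : q <=k r) :
    seg z r = mk_morphism (kcomp (imor z (nk_le0 q)) (imor z qr)).
  by rewrite -(imor_comp z (nk_le0 q) qr (nk_le0 r)).
have exy' : seg x n = seg y n.
  by move: exy; rewrite !(split_seg _ _ _ np) => /kcomp_cancel[];
    rewrite ?imor_deg.
by move: exy'; rewrite !(split_seg _ _ _ h) => /kcomp_cancel[];
  rewrite ?imor_deg.
Qed.

Lemma seg_le x y p q : q <=k p -> seg x p = seg y p -> seg x q = seg y q.
Proof. exact: seg_imor. Qed.

Lemma seg_src x y p : seg x p = seg y p -> x p = y p.
Proof. exact: (congr1 (@src k L)). Qed.

Lemma cylinder_seg x p y : cylinder (seg x p) y <-> seg x p = seg y p.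
Proof. by rewrite /cylinder /= degree_seg; split=> /esym. Qed.

Lemma cylinderE (l : morphism L) x : cylinder l x -> l = seg x (degree l).
Proof. by move=> /esym. Qed.

(** The two morphisms are entries of one and the same shifted path. *)
Lemma shift_imor x y p q (h : shift p x = shift q y) l m (lm : l <=k m)
    (xh : l + p <=k m + p) (yh : l + q <=k m + q) :
  mk_morphism (imor x xh) = mk_morphism (imor y yh).
Proof.
have := congr1 (fun z : ipath L => mk_morphism (imor z lm)) h => /= e.
by rewrite (bool_irrelevance xh (nk_le_add p lm)) e (bool_irrelevance yh (nk_le_add q lm)).
Qed.

End Segments.

(** * Transport of module elements along equalities of vertices *)

Section Transport.
Variables (k : nat) (L : kgraph k) (A : rmod L).
Implicit Types u v w : L.

Lemma transport_id v (e : v = v) (a : A v) : transport e a = a.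
Proof. by rewrite (Prop_irrelevance e erefl). Qed.

Lemma transport_trans u v w (e : u = v) (e' : v = w) (e'' : u = w) (a : A u) :
  transport e' (transport e a) = transport e'' a.
Proof. by subst v w; rewrite !transport_id. Qed.

Lemma transportB v w (e : v = w) : zmod_morphism (transport e : A v -> A w).
Proof. by subst w. Qed.
HB.instance Definition _ v w (e : v = w) :=
  GRing.isZmodMorphism.Build (A v) (A w) (transport e) (transportB e).

Lemma rmod_map_transport v w v' w' (f : khom v w) (g : khom v' w')
    (ev : v = v') (ew : w = w') (a : A v) :
  mk_morphism f = mk_morphism g ->
  rmod_map A g (transport ev a) = transport ew (rmod_map A f a).
Proof. by subst v' w' => /mk_morphism_inj ->; rewrite !transport_id. Qed.

Lemma rhom_transport (B : rmod L) (eta : rhom A B) v w (e : v = w) (a : A v) :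
  eta w (transport e a) = transport e (eta v a).
Proof. by subst w. Qed.

End Transport.

(** * Germs and their neighbourhoods *)

(** Two cylinders around [x] both contain the cylinder of a segment of [x] whose
    degree dominates theirs. *)
Lemma cylinder_basis (k : nat) (L : kgraph k) :
  basis [set cylinder l | l in [set: morphism L]].
Proof.
apply: (@gen_basis (ipath L) [set cylinder l | l in [set: morphism L]]).
  by move=> x; exists (cylinder (seg x 0)); [exists (seg x 0)|exact/cylinder_seg].
move=> _ _ x [l _ <-] [m _ <-] xl xm.
set n := nk_max (degree l) (degree m).
exists (cylinder (seg x n)); first by exists (seg x n).
split; first exact/cylinder_seg.
move=> y /cylinder_seg xy; split.
  rewrite (cylinderE xl); apply/cylinder_seg; apply: seg_le xy; exact: nk_le_maxl.
rewrite (cylinderE xm); apply/cylinder_seg; apply: seg_le xy; exact: nk_le_maxr.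
Qed.

Lemma nbhs_cylinder (k : nat) (L : kgraph k) (x : ipath L) (p : Nk k) :
  nbhs x [set y | seg x p = seg y p].
Proof.
have : nbhs x (cylinder (seg x p)).
  by apply: basis_open_nbhs (cylinder_basis L) _ _; [exists (seg x p)|exact/cylinder_seg].
by apply: filterS => y /cylinder_seg.
Qed.

Section Germs.
Variables (k : nat) (L : kgraph k) (A : rmod L).
Implicit Types (x y : ipath L) (p q r : Nk k).

Lemma germ_raise x p q (h : p <=k q) (a : A (x p)) :
  germ (rmod_map A (imor x h) a) = germ a.
Proof. exact: (@dlim_in_dmap k (path_sys A x)). Qed.

Lemma germ_eq x p q (a : A (x p)) (b : A (x q)) :
  germ a = germ b <-> exists r (hp : p <=k r) (hq : q <=k r),
    rmod_map A (imor x hp) a = rmod_map A (imor x hq) b.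
Proof. exact: (@dlim_eq k (path_sys A x)). Qed.

Lemma germ_surj x (z : ulstalk A x) : exists p (a : A (x p)), z = germ a.
Proof. exact: (@dlim_surj k (path_sys A x)). Qed.

Lemma germ_surj2 x (y z : ulstalk A x) :
  exists p (a b : A (x p)), y = germ a /\ z = germ b.
Proof. exact: (@dlim_surj2 k (path_sys A x)). Qed.

HB.instance Definition _ x p :=
  GRing.isZmodMorphism.Build (A (x p)) (ulstalk A x) (@germ k L A x p)
    (@dlim_in_is_additive k (path_sys A x) p).

Lemma germ_cast x p q (e : p = q) (e' : x p = x q) (a : A (x p)) :
  germ (transport e' a) = germ a.
Proof. by subst q; rewrite transport_id. Qed.

(** The set [S_{b, x(0,p)}], with membership written as an equation in one stalk
    rather than in the total space, and with [b] indexed by a path and a degree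
    instead of a morphism. *)
Definition germ_nbhd x p (b : A (x p)) : set {y : ipath L & ulstalk A y} :=
  [set e | exists E : seg x p = seg (projT1 e) p,
     projT2 e = germ (transport (seg_src E) b)].

Lemma germ_nbhd_germ_set x p (b : A (x p)) : germ_nbhd b = germ_set (l := seg x p) b.
Proof.
apply/predeqP => -[y z]; split=> [[/= E ->]|[y' [hy ->]]] /=.
  have hy : cylinder (seg x p) y by apply/cylinder_seg.
  exists y, hy; congr existT.
  have e : y p = y (degree (seg x p)) by rewrite degree_seg.
  rewrite -(germ_cast (esym (degree_seg x p)) e).
  by rewrite (transport_trans _ _ (cylinder_src hy)).
have /cylinder_seg E := hy; exists E.
have e : y' (degree (seg x p)) = y' p by rewrite degree_seg.
rewrite -(germ_cast (degree_seg x p) e).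
by rewrite (transport_trans _ _ (seg_src E)).
Qed.

Lemma germ_set_nbhd (l : morphism L) (a : A (src l)) x p :
  l = seg x p -> exists b : A (x p), germ_set a = germ_nbhd b.
Proof. by move=> El; subst l; exists a; rewrite germ_nbhd_germ_set. Qed.

Lemma germ_nbhd_mem x p (b : A (x p)) (z : ulstalk A x) :
  germ_nbhd b (existT _ x z) <-> z = germ b.
Proof.
by split=> [[/= E ->]|->]; [|exists erefl]; rewrite transport_id.
Qed.

Definition germ_basis : set (set {x : ipath L & ulstalk A x}) :=
  [set U | exists (l : morphism L) (a : A (src l)), U = germ_set a].

(** Any point of a basic open set can serve as its centre. *)
Lemma germ_basis_nbhd U x (z : ulstalk A x) :
  germ_basis U -> U (existT _ x z) ->
  exists p (b : A (x p)), z = germ b /\ U = germ_nbhd b.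
Proof.
move=> [l [a ->]] Uz; have [y [hy /(congr1 (@projT1 _ _)) /= xy]] := Uz.
subst y; have [b E] := germ_set_nbhd a (cylinderE hy).
by exists (degree l), b; split=> //; apply/germ_nbhd_mem; rewrite -E.
Qed.

Lemma germ_nbhd_basis x p (b : A (x p)) : germ_basis (germ_nbhd b).
Proof. by exists (seg x p), b; rewrite germ_nbhd_germ_set. Qed.

(** A path that shares [x(0, q)] also shares [x(p, q)], so it maps [b] to the same
    element in degree [q]. *)
Lemma germ_nbhd_raise x p q (h : p <=k q) (b : A (x p)) :
  germ_nbhd (rmod_map A (imor x h) b) `<=` germ_nbhd b.
Proof.
move=> [y z] [/= E ->]; exists (seg_le h E) => /=.
rewrite -(rmod_map_transport (seg_src (seg_le h E)) _ _ (seg_imor h (nk_le_refl q) E)).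
exact: germ_raise.
Qed.

(** Equal germs have equal representatives in some degree [r], hence agree over
    the cylinder of [x(0, r)]. This gives continuity of sections, operations and
    induced maps. *)
Lemma germ_nbhd_refine x p q (b : A (x p)) (c : A (x q)) : germ b = germ c ->
  exists r (h : p <=k r), germ_nbhd (rmod_map A (imor x h) b) `<=` germ_nbhd c.
Proof.
by move=> /germ_eq[r [hp [hq e]]]; exists r, hp; rewrite e; exact: germ_nbhd_raise.
Qed.

Lemma germ_basisP : basis (germ_basis : set (set (total (ulsheaf A)))).
Proof.
apply: gen_basis.
  move=> [x z]; have [p [b ->]] := germ_surj z.
  by exists (germ_nbhd b); [exact: germ_nbhd_basis|exact/germ_nbhd_mem].
move=> U V [x z] BU BV Uz Vz.
have [p [b [zb ->]]] := germ_basis_nbhd BU Uz; subst z.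
have [q [c [/germ_eq[r [hp [hq e]]] ->]]] := germ_basis_nbhd BV Vz.
exists (germ_nbhd (rmod_map A (imor x hp) b)); first exact: germ_nbhd_basis.
split; first by apply/germ_nbhd_mem; rewrite germ_raise.
by move=> t tb; split; [exact: germ_nbhd_raise tb|move: tb; rewrite e; exact: germ_nbhd_raise].
Qed.

Lemma nbhs_germ_nbhd x p (b : A (x p)) :
  nbhs (existT _ x (germ b) : total (ulsheaf A)) (germ_nbhd b).
Proof.
exact: basis_open_nbhs germ_basisP (germ_nbhd_basis b) ((germ_nbhd_mem b _).2 erefl).
Qed.

End Germs.

(** * The sheaf of germs *)

Section UnderlineSheaf.
Variables (k : nat) (L : kgraph k) (A : rmod L).
Implicit Types (x y : ipath L) (p q r : Nk k).

(** The local section through [b] over the cylinder of [x(0, p)], extended by zero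
    to all paths because [local_homeo] asks for a total function. *)
Definition germ_section x p (b : A (x p)) y : total (ulsheaf A) :=
  match pselect (seg x p = seg y p) with
  | left E => existT _ y (germ (transport (seg_src E) b))
  | right _ => pt (0 : ulsheaf A y)
  end.

Lemma germ_sectionE x p (b : A (x p)) y (E : seg x p = seg y p) :
  germ_section b y = existT _ y (germ (transport (seg_src E) b)).
Proof.
rewrite /germ_section; case: pselect => [E'|/(_ E) []].
by rewrite (Prop_irrelevance E' E).
Qed.

Lemma germ_section_cts x p (b : A (x p)) y : seg x p = seg y p ->
  {for y, continuous (germ_section b)}.
Proof.
move=> E V; rewrite /= (germ_sectionE b E) => /(basis_nbhs (@germ_basisP k L A)).
move=> [U BU [Uy UV]]; have [q [c [e UE]]] := germ_basis_nbhd BU Uy.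
have [r [h rc]] := germ_nbhd_refine e.
apply: filterS (nbhs_cylinder y r) => t yt /=; apply: UV; rewrite UE; apply: rc.
have yt' := seg_le h yt; rewrite (germ_sectionE b (etrans E yt')).
exists yt => /=.
rewrite -(rmod_map_transport (seg_src yt') _ _ (seg_imor h (nk_le_refl r) yt)).
by rewrite germ_raise (transport_trans _ _ (seg_src (etrans E yt'))).
Qed.

Lemma ul_proj_cts : continuous (proj (S := ulsheaf A)).
Proof.
apply: (basis_continuous (cylinder_basis L)) => -[x z] _ [l _ <-] /= xl.
have [p [b ->]] := germ_surj z.
have h := nk_le_maxl p (degree l).
exists (germ_nbhd (rmod_map A (imor x h) b)).
  by rewrite -(germ_raise h b); exact: nbhs_germ_nbhd.
move=> [y t] [/= E _]; rewrite (cylinderE xl); apply/cylinder_seg.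
exact: seg_le (nk_le_maxr _ _) E.
Qed.

Lemma ul_local_homeo : local_homeo (proj (S := ulsheaf A)).
Proof.
move=> [x z]; have [p [b ->]] := germ_surj z.
have projE : proj (S := ulsheaf A) @` germ_nbhd b = [set y | seg x p = seg y p].
  apply/predeqP => y; split=> [[e [E _] <-] //|/= E].
  by exists (germ_section b y); rewrite (germ_sectionE b E) //; exists E.
have oP : open [set y | seg x p = seg y p].
  by rewrite openE => y /= ->; exact: nbhs_cylinder.
exists (germ_nbhd b), (germ_section b); rewrite projE; split; split.
- exact: (germ_basisP A).1 _ (germ_nbhd_basis b).
- exact/germ_nbhd_mem.
- exact: oP.
- exact: continuous_subspaceT ul_proj_cts.
- rewrite continuous_open_subspace // => y; rewrite inE => E.
  exact: germ_section_cts.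
- by move=> [y t]; rewrite inE => -[/= E ->]; rewrite germ_sectionE.
Qed.

Lemma ul_add_cts : continuous_along
  (fun t : fiber_square (ulsheaf A) => (pt (projT2 t).1, pt (projT2 t).2))
  (fun t => pt ((projT2 t).1 + (projT2 t).2)).
Proof.
apply: (continuous_along_basis (@germ_basisP k L A)).
move=> [x [z1 z2]] U BU /= Uz; have [q [c [zc ->]]] := germ_basis_nbhd BU Uz.
have [p [b1 [b2 [z1b z2b]]]] := germ_surj2 z1 z2; subst z1 z2.
move: zc; rewrite -raddfD => /germ_nbhd_refine[r [h rc]].
exists (germ_nbhd (rmod_map A (imor x h) b1) `*` germ_nbhd (rmod_map A (imor x h) b2)).
  exists (germ_nbhd (rmod_map A (imor x h) b1), germ_nbhd (rmod_map A (imor x h) b2)) => //.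
  by rewrite -(germ_raise h b1) -(germ_raise h b2); split; exact: nbhs_germ_nbhd.
move=> [y [t1 t2]] /= [[/= E ->] [/= E' ->]]; apply: rc; exists E => /=.
by rewrite (Prop_irrelevance E' E) !raddfD.
Qed.

Lemma ul_opp_cts : continuous (fun e : total (ulsheaf A) => pt (- projT2 e)).
Proof.
apply: (basis_continuous (@germ_basisP k L A)).
move=> [x z] U BU /= Uz; have [q [c [zc ->]]] := germ_basis_nbhd BU Uz.
have [p [b zb]] := germ_surj z; subst z.
move: zc; rewrite -raddfN => /germ_nbhd_refine[r [h rc]].
exists (germ_nbhd (rmod_map A (imor x h) b)).
  by rewrite -(germ_raise h b); exact: nbhs_germ_nbhd.
by move=> [y t] [/= E ->]; apply: rc; exists E; rewrite /= !raddfN.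
Qed.

Lemma ul_zero_cts : continuous (fun x : ipath L => pt (0 : ulsheaf A x)).
Proof.
apply: (basis_continuous (@germ_basisP k L A)).
move=> x U BU /= Uz; have [q [c [zc ->]]] := germ_basis_nbhd BU Uz.
move: zc; rewrite -(raddf0 (@germ k L A x q)) => /germ_nbhd_refine[r [h rc]].
exists [set y | seg x r = seg y r]; first exact: nbhs_cylinder.
by move=> y E; apply: rc; exists E; rewrite /= !raddf0.
Qed.

Lemma ul_is_sheaf : is_sheaf (ulsheaf A).
Proof.
split; [exact: ul_local_homeo|exact: ul_add_cts|exact: ul_opp_cts|exact: ul_zero_cts].
Qed.

End UnderlineSheaf.

(** * The action of the path groupoid *)

Section Action.
Variables (k : nat) (L : kgraph k) (A : rmod L).
Implicit Types (x y : ipath L) (p q r : Nk k).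

Lemma shift_raise x y p q r : shift p x = shift q y -> q <=k r ->
  shift (nk_sub r q + p) x = shift r y.
Proof. by move=> h qr; rewrite -shiftD h shiftD nk_subK. Qed.

(** Transport along the common shifted path is natural: the morphisms [x(p, P)]
    and [y(q, r)] are both the initial segment of degree [r - q] of
    [shift p x = shift q y]. *)
Lemma shift_map x y p q P r (h : shift p x = shift q y)
    (h' : shift P x = shift r y) (pP : p <=k P) (qr : q <=k r) (b : A (y q)) :
  P = nk_sub r q + p ->
  rmod_map A (imor x pP) (transport (shift_vertex h) b) =
  transport (shift_vertex h') (rmod_map A (imor y qr) b).
Proof.
move=> EP; apply: rmod_map_transport; subst P.
have lm := nk_le0 (nk_sub r q).
(* Rewrite both sides as the entry (0, r - q) of a shifted path. *)
rewrite (imor_cast y qr (nk_le_add q lm)) ?add0r ?nk_subK //.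
rewrite (imor_cast x pP (nk_le_add p lm)) ?add0r //.
exact/esym/shift_imor.
Qed.

Lemma germ_shift x y p q P r (h : shift p x = shift q y)
    (h' : shift P x = shift r y) (qr : q <=k r) (b : A (y q)) :
  P = nk_sub r q + p ->
  germ (transport (shift_vertex h) b) =
  germ (transport (shift_vertex h') (rmod_map A (imor y qr) b)).
Proof.
move=> EP; have pP : p <=k P by rewrite EP nk_le_addr.
by rewrite -(shift_map h h' pP qr b EP) germ_raise.
Qed.

(** The defining formula of the action as a relation between germs; it is total
    and single-valued, and the action is the function with this graph. *)
Definition action_rel x y (g : path_arr x y) (z : ulstalk A y) (w : ulstalk A x) :=
  exists p q (h : shift p x = shift q y) (b : A (y q)),
    [/\ nk_int p = sval g + nk_int q, z = germ b &
        w = germ (transport (shift_vertex h) b)].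

(** Both representatives are raised to a degree [r] at which they agree. The
    corresponding degrees along [x] are then equal as well, since each is the
    degree of [g] plus [r]. *)
Lemma action_rel_fun x y (g : path_arr x y) z w w' :
  action_rel g z w -> action_rel g z w' -> w = w'.
Proof.
move=> [p [q [h [b [pq -> ->]]]]] [p' [q' [h' [b' [pq' /germ_eq[r [qr [qr' e]]] ->]]]]].
have H := shift_raise h qr.
rewrite (germ_shift h H qr _ erefl) (germ_shift h' H qr') ?e //.
by apply: nk_int_inj; rewrite (nk_int_raise pq qr) (nk_int_raise pq' qr').
Qed.

Lemma action_rel_total x y (g : path_arr x y) z : exists w, action_rel g z w.
Proof.
case: g => n [j [l [nE h]]]; have [m [b ->]] := germ_surj z.
have H : shift (m + j) x = shift (m + l) y by rewrite -shiftD h shiftD.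
have ml : m <=k m + l by rewrite addrC nk_le_addr.
exists (germ (transport (shift_vertex H) (rmod_map A (imor y ml) b))).
exists (m + j), (m + l), H, (rmod_map A (imor y ml) b); split=> //=.
  by rewrite nE !nk_intD [RHS]addrCA addrNK.
by rewrite germ_raise.
Qed.

Definition ul_action : path_action A :=
  fun x y g z => sval (cid (action_rel_total g z)).

Lemma ul_actionP : is_path_action ul_action.
Proof.
move=> x y g p q h pq b; apply: action_rel_fun (svalP (cid _)) _.
by exists p, q, h, b.
Qed.

Lemma ul_actionB x y (g : path_arr x y) : zmod_morphism (@ul_action x y g).
Proof.
have [j [l [nE h]]] := svalP g.
move=> z z'; have [m [b [b' [-> ->]]]] := germ_surj2 z z'.
have H : shift (m + j) x = shift (m + l) y by rewrite -shiftD h shiftD.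
have ml : m <=k m + l by rewrite addrC nk_le_addr.
have E : nk_int (m + j) = sval g + nk_int (m + l).
  by rewrite nE !nk_intD [RHS]addrCA addrNK.
rewrite -(germ_raise ml b) -(germ_raise ml b') -raddfB.
by rewrite !(ul_actionP H E) -!raddfB.
Qed.

Lemma ul_action1 x (z : ulstalk A x) : ul_action (path_id x) z = z.
Proof.
have [p [b ->]] := germ_surj z.
by rewrite (ul_actionP (erefl (shift p x))) ?transport_id // add0r.
Qed.

(** For the degrees [j - l] of [g] and [j' - l'] of [h], raising a representative
    [b] of degree [m] to [m + l + l'] leaves room to apply [h] and then [g], the
    degree along the middle path being [m + j' + l]. *)
Lemma ul_actionM x y t (g : path_arr x y) (h : path_arr y t) (z : ulstalk A t) :
  ul_action g (ul_action h z) = ul_action (path_mul g h) z.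
Proof.
have [j [l [gE eg]]] := svalP g; have [j' [l' [hE eh]]] := svalP h.
have [m [b ->]] := germ_surj z.
pose p := m + j' + j; pose q := m + j' + l; pose r := m + l + l'.
have epq : shift p x = shift q y by rewrite -shiftD eg shiftD.
have eqr : shift q y = shift r t.
  by rewrite /q (addrAC m) -(shiftD (m + l)) eh shiftD.
have mr : m <=k r by rewrite /r -addrA addrC nk_le_addr.
have pqE : nk_int p = sval g + nk_int q by rewrite gE !nk_intD [RHS]addrCA addrNK.
have qrE : nk_int q = sval h + nk_int r.
  by rewrite hE !nk_intD [RHS]addrCA addrNK addrAC.
rewrite -(germ_raise mr b) (ul_actionP eqr qrE) (ul_actionP epq pqE).
rewrite (transport_trans _ _ (shift_vertex (etrans epq eqr))).
by rewrite (ul_actionP (etrans epq eqr)) //= pqE qrE addrA.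
Qed.

Lemma ul_action_bij x y (g : path_arr x y) : bijective (@ul_action x y g).
Proof.
exists (ul_action (path_inv g)) => z; rewrite ul_actionM.
  by rewrite -[RHS]ul_action1; congr (ul_action _ z); apply: path_arr_eq => /=; rewrite addNr.
by rewrite -[RHS]ul_action1; congr (ul_action _ z); apply: path_arr_eq => /=; rewrite subrr.
Qed.

Lemma nbhs_bicylinder x y (g : path_arr x y) p q :
    shift p x = shift q y -> nk_int p = sval g + nk_int q ->
  nbhs (existT _ (x, y) g : garrows (path_groupoid L))
    (bicylinder (seg x p) (seg y q)).
Proof.
move=> h pq; apply: open_nbhs_nbhs; split.
  apply: gen_open; exists (seg x p), (seg y q); split=> //.
  exact/esym/shift_vertex.
split=> /=; first by rewrite !degree_seg pq addrK.
exists (shift p x); split; split; rewrite ?degree_seg //; exact/cylinder_seg.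
Qed.

(** Raise the representatives until the germ neighbourhood of the value lies in
    the given open set. Then the product of the bicylinder of [x(0, r)] and
    [y(0, s)] with the neighbourhood of the germ over [y] is mapped into it: on
    that bicylinder the action is transport from degree [s] to degree [r]. *)
Lemma ul_action_cts : continuous_along
  (fun t : act_domain (ulgsheaf ul_action) => (projT1 t, pt (projT2 t)))
  (fun t => pt (gact (ulgsheaf ul_action) (projT2 (projT1 t)) (projT2 t))).
Proof.
apply: (continuous_along_basis (@germ_basisP k L A)).
move=> [[[x y] g] z] U BU /= Uz.
have [q0 [c [zc ->]]] := germ_basis_nbhd BU Uz.
have [p [q [h [b [pq zb zw]]]]] := svalP (cid (action_rel_total g z)).
have [r [pr rc]] := germ_nbhd_refine (etrans (esym zw) zc); subst z.
pose s := nk_sub r p + q.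
have qs : q <=k s := nk_le_addr q _.
have rE : r = nk_sub s q + p.
  have -> : nk_sub s q = nk_sub r p by apply/ffunP => i; rewrite /s !ffunE; exact: addnK.
  by rewrite nk_subK.
have H : shift r x = shift s y by rewrite rE; exact: shift_raise.
have rs : nk_int r = sval g + nk_int s.
  by rewrite rE; exact: nk_int_raise.
move: rc; rewrite (shift_map h H pr qs b rE).
set b1 := rmod_map A (imor y qs) b => rc.
exists (bicylinder (seg x r) (seg y s) `*` germ_nbhd b1).
  exists (bicylinder (seg x r) (seg y s), germ_nbhd b1) => //; split.
    exact: nbhs_bicylinder.
  by rewrite -(germ_raise qs b); exact: nbhs_germ_nbhd.
move=> [[[x' y'] g'] a'] /= [[gE [z' [[xx' ex] [yy' ey]]]] [E aE]].
rewrite /= in E aE; subst a'; apply: rc.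
move: xx' yy' gE ex ey => /cylinder_seg E' _; rewrite !degree_seg => gE ex ey.
have h' : shift r x' = shift s y' by rewrite ex ey.
exists E' => /=; rewrite (ul_actionP h'); last by rewrite gE addrNK.
rewrite (transport_trans _ _ (etrans (seg_src E) (shift_vertex h'))).
by rewrite (transport_trans _ _ (etrans (seg_src E) (shift_vertex h'))).
Qed.

Lemma ul_is_gsheaf : is_gsheaf (ulgsheaf ul_action).
Proof.
split; first exact: ul_is_sheaf.
split; last exact: ul_action_cts.
- by move=> x y g; split; [exact: ul_actionB|exact: ul_action_bij].
- exact: ul_action1.
- exact: ul_actionM.
Qed.

End Action.

(** * Functoriality and exactness *)

Section UnderlineMap.
Variables (k : nat) (L : kgraph k).
Implicit Types (A B C : rmod L) (x y : ipath L).

Lemma ul_map_exists A B (eta : rhom A B) x :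
  exists f : ulstalk A x -> ulstalk B x,
    zmod_morphism f /\ forall p (a : A (x p)), f (germ a) = germ (eta (x p) a).
Proof.
have [|f [[fB fE] _]] := @dlim_universal k (path_sys A x) (ulstalk B x)
  (fun p => (@germ k L B x p : {additive B (x p) -> ulstalk B x}) \o eta (x p)).
  by move=> p q h a /=; rewrite rhom_nat germ_raise.
by exists f.
Qed.

Definition ul_map A B (eta : rhom A B) x : ulstalk A x -> ulstalk B x :=
  sval (cid (ul_map_exists eta x)).

Lemma ul_mapE A B (eta : rhom A B) x p (a : A (x p)) :
  ul_map eta (germ a) = germ (eta (x p) a).
Proof. by rewrite /ul_map; case: cid => f []. Qed.

Lemma ul_mapB A B (eta : rhom A B) x : zmod_morphism (ul_map eta (x := x)).
Proof. by rewrite /ul_map; case: cid => f []. Qed.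
HB.instance Definition _ A B (eta : rhom A B) x :=
  GRing.isZmodMorphism.Build (ulstalk A x) (ulstalk B x) (@ul_map A B eta x)
    (@ul_mapB A B eta x).

Definition ul A : gsheaf (path_groupoid L) := GSheaf (ul_is_gsheaf A).

Lemma ul_map_cts A B (eta : rhom A B) :
  continuous (fun e : total (ulsheaf A) => pt (S := ulsheaf B) (ul_map eta (projT2 e))).
Proof.
apply: (basis_continuous (@germ_basisP k L B)).
move=> [x z] U BU /= Uz; have [q [c [zc ->]]] := germ_basis_nbhd BU Uz.
have [p [b zb]] := germ_surj z; subst z.
move: zc; rewrite ul_mapE => /germ_nbhd_refine[r [h rc]].
exists (germ_nbhd (rmod_map A (imor x h) b)).
  by rewrite -(germ_raise h b); exact: nbhs_germ_nbhd.
move=> [y t] [/= E ->]; apply: rc; exists E => /=.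
by rewrite ul_mapE rhom_transport rhom_nat.
Qed.

Lemma ul_map_act A B (eta : rhom A B) x y (g : path_arr x y) (z : ulstalk A y) :
  ul_map eta (ul_action g z) = ul_action g (ul_map eta z).
Proof.
have [p [q [h [b [pq -> _]]]]] := svalP (cid (action_rel_total g z)).
by rewrite (ul_actionP h pq) !ul_mapE (ul_actionP h pq) rhom_transport.
Qed.

Lemma ul_map_ax A B (eta : rhom A B) : is_ghom (S := ul A) (T := ul B) (@ul_map A B eta).
Proof. by split; [exact: ul_mapB|exact: ul_map_act|exact: ul_map_cts]. Qed.

Definition ul_hom A B (eta : rhom A B) : ghom (ul A) (ul B) := GHom (ul_map_ax eta).

Lemma ul_hom_uniq A B (f g : ghom (ul A) (ul B)) :
  (forall x p (a : A (x p)), f x (germ a) = g x (germ a)) -> f = g.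
Proof.
by move=> fg; apply: ghom_eq => x z; have [p [a ->]] := germ_surj z.
Qed.

Definition ul_functor :
  functor_on (C := rmod_cat L) (D := gsheaf_cat (path_groupoid L)) ul.
Proof.
exists (@ul_hom).
- by move=> A; apply: ul_hom_uniq => x p a; rewrite /= ul_mapE.
- by move=> A B C g f; apply: ul_hom_uniq => x p a; rewrite /= !ul_mapE.
Defined.

Lemma ul_map_exact A B C (f : rhom A B) (g : rhom B C) :
    (forall v (b : B v), g v b = 0 <-> exists a, b = f v a) ->
  forall x (z : ulstalk B x), ul_map g z = 0 <-> exists a, z = ul_map f a.
Proof.
move=> fg x z; split.
  have [p [b ->]] := germ_surj z.
  rewrite ul_mapE -(raddf0 (@germ k L C x 0)) => /germ_eq[r [h [h0]]].
  rewrite raddf0 -rhom_nat => /fg[a E].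
  by exists (germ a); rewrite ul_mapE -E germ_raise.
move=> [a ->]; have [p [b ->]] := germ_surj a.
by rewrite !ul_mapE (fg _ _).2 ?raddf0 //; exists b.
Qed.

Lemma ul_map_inj A B (f : rhom A B) : (forall v, injective (f v)) ->
  forall x, injective (ul_map f (x := x)).
Proof.
move=> f_inj x z t; have [p [a [b [-> ->]]]] := germ_surj2 z t.
rewrite !ul_mapE => /germ_eq[r [h [h']]]; rewrite -!rhom_nat => /f_inj E.
by apply/germ_eq; exists r, h, h'.
Qed.

Lemma ul_map_surj A B (f : rhom A B) : (forall v b, exists a, b = f v a) ->
  forall x (z : ulstalk B x), exists t, z = ul_map f t.
Proof.
move=> f_surj x z; have [p [b ->]] := germ_surj z.
by have [a ->] := f_surj _ b; exists (germ a); rewrite ul_mapE.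
Qed.

(** The module kernel of [g] is also the kernel of the cokernel map of [f], by
    exactness; applying the functor to it and to the cokernel of [f] gives
    witnesses of exactness, each of which is checked on stalks. *)
Lemma ul_exact : exact_functor ul_functor.
Proof.
move=> A B C f g /rmod_exactP fg.
have cf v b : qmod_pi f v b = 0 <-> exists a, b = (f : rhom A B) v a.
  exact: coker_pi0.
have ci v b : qmod_pi f v b = 0 <-> exists a, b = kmod_in g v a.
  rewrite cf -fg; split=> [gb|[a ->]]; last exact: (svalP a).
  by exists (exist _ b gb).
have gi v b : (g : rhom B C) v b = 0 <-> exists a, b = kmod_in g v a.
  by rewrite -ci cf.
have i_inj := ul_map_inj (f := kmod_in g) (fun v => @ker_eq _ _ _).
exists (ul (qmod f)), (ul_hom (qmod_pi f)), (ul (kmod g)), (ul_hom (kmod_in g)).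
split.
- apply: ghom_cokernel => x; last exact: ul_map_exact cf x.
  by apply: ul_map_surj => v b; exact: coker_surj.
- by apply: ghom_kernel => x; [exact: i_inj|exact: ul_map_exact ci x].
- by apply: ghom_kernel => x; [exact: i_inj|exact: ul_map_exact gi x].
Qed.

End UnderlineMap.

Theorem theorem3p7 (k : nat) (L : kgraph k) (rowfinite : row_finite_no_sources L) :
  exists2 alpha : forall A : rmod L, path_action A,
    forall A : rmod L, is_path_action (alpha A) &
  exists UAx : forall A : rmod L, is_gsheaf (ulgsheaf (alpha A)),
  let U (A : rmod L) : gsheaf (path_groupoid L) := GSheaf (UAx A) in
  (forall (A B : rmod L) (eta : rhom A B),
     (forall x : ipath L,
        let etaA p q (h : p <=k q) (a : A (x p)) : B (x q) :=
          eta (x q) (rmod_map A (imor x h) a) in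
        let Beta p q (h : p <=k q) (a : A (x p)) : B (x q) :=
          rmod_map B (imor x h) (eta (x p) a) in
        exists f g : {additive ulstalk A x -> ulstalk B x},
          [/\ is_dlim_map (D := path_sys A x) (E := path_sys B x) etaA f,
              is_dlim_map (D := path_sys A x) (E := path_sys B x) Beta g &
              f =1 g]) /\
     exists! ueta : ghom (U A) (U B),
       forall (x : ipath L) (p : Nk k) (a : A (x p)),
         ueta x (germ a) = germ (eta (x p) a)) /\
  exists F : functor_on (C := rmod_cat L) (D := gsheaf_cat (path_groupoid L)) U,
    [/\ forall (A B : rmod L) (eta : rhom A B) (x : ipath L) (p : Nk k) (a : A (x p)),
          (F A B eta : ghom (U A) (U B)) x (germ a) = germ (eta (x p) a),
        exact_functor F &
        forall (A B : rmod_cat L) (eta theta : mor A B),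
          F A B (eta + theta) = F A B eta + F A B theta].
Proof.
exists (fun A => @ul_action k L A) => [A|]; first exact: ul_actionP.
exists (@ul_is_gsheaf k L); split=> [A B eta|].
  split=> [x etaA Beta|].
    exists (@ul_map k L A B eta x), (@ul_map k L A B eta x); split=> // p q h a.
      by rewrite [LHS]ul_mapE /etaA rhom_nat [RHS]germ_raise.
    by rewrite [LHS]ul_mapE [RHS]germ_raise.
  exists (ul_hom eta); split=> [x p a|f fE]; first exact: ul_mapE.
  by apply: ul_hom_uniq => x p a; rewrite fE [LHS]ul_mapE.
exists (ul_functor L); split=> [A B eta x p a||A B eta theta].
- exact: ul_mapE.
- exact: ul_exact.
- by apply: ul_hom_uniq => x p a; rewrite /= !ul_mapE raddfD.
Qed.
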